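(* There is a one-to-one correspondence, up to monoidal equivalence, between monoidal categories - $\mathbf{C}$ with distributive, monic finite phased coproducts with transitive phases; - $\mathbf{D}$ with distributive, monic finite coproducts and a choice of global phases $\mathbb{P}$; given by $\mathbf{C} \mapsto \mathsf{GP}(\mathbf{C})$ and $\mathbf{D} \mapsto \mathbf{D}_{\mathbb{P}}$.
   Context: **Phased coproducts.** A phased coproduct of a family $(A_i)_{i \in J}$ of objects is an object $A$ with morphisms $\kappa_i \colon A_i \to A$ (coprojections) such that: (i) for every family $f_i \colon A_i \to B$ there is $f \colon A \to B$ with $f \circ \kappa_i = f_i$ for all $i$; (ii) any $f, f' \colon A \to B$ with $f \circ \kappa_i = f' \circ \kappa_i$ for all $i$ satisfy $f' = f \circ U$ for some endomorphism $U$ of $A$ with $U \circ \kappa_i = \kappa_i$ for all $i$. Any endomorphism $U$ with $U \circ \kappa_i = \kappa_i$ for all $i$ is called a phase. Binary: $A \mathbin{\dot{+}} B$. Finite phased coproducts: every finite (possibly empty) family has one. (Phased) coproducts are monic if all coprojections are monomorphisms. A morphism $f \colon A \mathbin{\dot{+}} B \to C \mathbin{\dot{+}} D$ is diagonal if $f \circ \kappa_A = \kappa_C \circ g$ and $f \circ \kappa_B = \kappa_D \circ h$ for some $g, h$. Phases are transitive if for every such diagonal $f$ and phase $U$ of $A \mathbin{\dot{+}} B$ there is a phase $V$ of $C \mathbin{\dot{+}} D$ with $f \circ U = V \circ f$. **Distributivity.** Phased coproducts in a monoidal category are distributive if for every object $A$ the functors $F = A \otimes (-)$ and $F = (-) \otimes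 A$ strongly preserve them: for every phased coproduct $B \mathbin{\dot{+}} C$, $F(B \mathbin{\dot{+}} C)$ with $F(\kappa_B), F(\kappa_C)$ is a phased coproduct of $F(B), F(C)$, all of whose phases have the form $F(U)$ for a phase $U$ of $B \mathbin{\dot{+}} C$. For ordinary coproducts this is the usual distributivity. **Global phases.** A scalar in a monoidal category is a morphism $s \colon I \to I$; for $f \colon A \to B$ put $s \cdot f = \lambda_B \circ (s \otimes f) \circ \lambda_A^{-1}$ and $f \cdot s = \rho_B \circ (f \otimes s) \circ \rho_A^{-1}$. A scalar $s$ is central if $s \cdot f = f \cdot s$ for all $f$. A choice of global phases is a collection $\mathbb{P}$ of invertible central scalars closed under composition and inverses. $\mathbf{D}_{\mathbb{P}}$ is the quotient of $\mathbf{D}$ by the congruence $f \sim g$ iff $f = u \cdot g$ for some $u \in \mathbb{P}$, with the monoidal structure inherited from $\mathbf{D}$. **$\mathsf{GP}(\mathbf{C})$.** Objects are phased coproducts $\mathbf{A} = A \mathbin{\dot{+}} I$ in $\mathbf{C}$ ($I$ the monoidal unit; $A, I, \kappa_A,\kappa_I$ are part of the data); morphisms $\mathbf{A} \to \mathbf{B}$ are diagonal morphisms $f$ of $\mathbf{C}$ with $f \circ \kappa_I = \kappa_I$; composition as in $\mathbf{C}$. Monoidal structure: for each $\mathbf{A}, \mathbf{B}$ choose an object $\mathbf{A} \widehat{\otimes} \mathbf{B} = (A \otimes B) \mathbin{\dot{+}} I$ and a morphism $c_{\mathbf{A},\mathbf{B}} \colon \mathbf{A} \widehat{\otimes} \mathbf{B}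 \to \mathbf{A} \otimes \mathbf{B}$ of $\mathbf{C}$ with $c_{\mathbf{A},\mathbf{B}} \circ \kappa_{A \otimes B} = \kappa_A \otimes \kappa_B$ and $c_{\mathbf{A},\mathbf{B}} \circ \kappa_I = (\kappa_I \otimes \kappa_I) \circ \rho_I^{-1}$; $f \widehat{\otimes} g$ is the unique morphism with $c \circ (f \widehat{\otimes} g) = (f \otimes g) \circ c$; the associator $\boldsymbol{\alpha}$ is the unique morphism with $(\mathrm{id}_{\mathbf{A}} \otimes c_{\mathbf{B},\mathbf{E}}) \circ c_{\mathbf{A}, \mathbf{B} \widehat{\otimes} \mathbf{E}} \circ \boldsymbol{\alpha}_{\mathbf{A},\mathbf{B},\mathbf{E}} = \alpha_{\mathbf{A},\mathbf{B},\mathbf{E}} \circ (c_{\mathbf{A},\mathbf{B}} \otimes \mathrm{id}_{\mathbf{E}}) \circ c_{\mathbf{A} \widehat{\otimes} \mathbf{B}, \mathbf{E}}$; the unit is a chosen $\mathbf{I} = I \mathbin{\dot{+}} I$ with a chosen isomorphism $\beta \colon \mathbf{I} \widehat{\otimes} \mathbf{I} \to \mathbf{I}$ satisfying $\beta \circ \kappa_1 = \kappa_1 \circ \rho_I$, $\beta \circ \kappa_2 = \kappa_2$, the unitors being determined by $\boldsymbol{\rho}_{\mathbf{A}} \widehat{\otimes} \mathrm{id}_{\mathbf{I}} = (\mathrm{id}_{\mathbf{A}} \widehat{\otimes} \beta) \circ \boldsymbol{\alpha}_{\mathbf{A},\mathbf{I},\mathbf{I}}$ and $\mathrm{id}_{\mathbf{I}}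 \widehat{\otimes} \boldsymbol{\lambda}_{\mathbf{A}} = (\beta \widehat{\otimes} \mathrm{id}_{\mathbf{A}}) \circ \boldsymbol{\alpha}^{-1}_{\mathbf{I},\mathbf{I},\mathbf{A}}$. $\mathsf{GP}(\mathbf{C})$ carries the canonical choice of global phases $\mathbb{P} = \{u \colon \mathbf{I} \to \mathbf{I} \mid u \text{ is a phase of } I \mathbin{\dot{+}} I \text{ in } \mathbf{C}\}$. *)

(* Defs.v *)
From mathcomp Require Import all_boot.
From Stdlib Require Import Setoid Morphisms.

Set Implicit Arguments.
Unset Strict Implicit.
Unset Printing Implicit Defensive.

Declare Scope cat_scope.
Delimit Scope cat_scope with cat.
Local Open Scope cat_scope.

(** Hom-sets are setoids: [heq] is the equality of parallel morphisms.  In this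
    way the quotient of a category by a congruence keeps its objects and
    morphisms and only replaces [heq]. *)

Record Category := {
  Obj :> Type;
  Hom : Obj -> Obj -> Type;
  heq : forall A B : Obj, Hom A B -> Hom A B -> Prop;
  idm : forall A : Obj, Hom A A;
  comp : forall A B E : Obj, Hom B E -> Hom A B -> Hom A E;
  heq_equiv : forall A B : Obj, Equivalence (@heq A B);
  comp_heq : forall A B E : Obj,
    Proper (@heq B E ==> @heq A B ==> @heq A E) (@comp A B E);
  comp_assoc : forall (A B E F : Obj) (h : Hom E F) (g : Hom B E) (f : Hom A B),
    heq (comp h (comp g f)) (comp (comp h g) f);
  comp_idl : forall (A B : Obj) (f : Hom A B), heq (comp (idm B) f) f;
  comp_idr : forall (A B : Obj) (f : Hom A B), heq (comp f (idm A)) f }.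

Arguments Hom {_} _ _.
Arguments heq {_ _ _} _ _.
Arguments idm {_} _.
Arguments comp {_ _ _ _} _ _.

Notation "f ≡ g" := (heq f g) (at level 70, no associativity) : cat_scope.
Notation "g ∘ f" := (comp g f) (at level 40, left associativity) : cat_scope.

#[export] Existing Instance heq_equiv.
#[export] Existing Instance comp_heq.
#[local] Hint Extern 0 (heq _ _) => reflexivity : core.

Record Iso (C : Category) (A B : C) := {
  fwd :> Hom A B;
  bwd : Hom B A;
  bwdK : bwd ∘ fwd ≡ idm A;
  fwdK : fwd ∘ bwd ≡ idm B }.

Definition monic (C : Category) (A B : C) (m : Hom A B) : Prop :=
  forall (X : C) (f g : Hom X A), m ∘ f ≡ m ∘ g -> f ≡ g.

Record Functor (C D : Category) := {
  fob :> C -> D;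
  fmap : forall A B : C, Hom A B -> Hom (fob A) (fob B);
  fmap_heq : forall A B : C, Proper (@heq C A B ==> heq) (@fmap A B);
  fmap_id : forall A : C, fmap (idm A) ≡ idm (fob A);
  fmap_comp : forall (A B E : C) (g : Hom B E) (f : Hom A B),
    fmap (g ∘ f) ≡ fmap g ∘ fmap f }.

#[export] Existing Instance fmap_heq.

(** [F] is an equivalence of categories: it has a quasi-inverse [G]. *)
Definition is_equivalence (C D : Category) (F : Functor C D) : Prop :=
  exists G : Functor D C,
    (exists eta : forall A : C, Iso (G (F A)) A,
      forall (A B : C) (f : Hom A B), f ∘ eta A ≡ eta B ∘ fmap G (fmap F f)) /\
    (exists eps : forall X : D, Iso (F (G X)) X,
      forall (X Y : D) (f : Hom X Y), f ∘ eps X ≡ eps Y ∘ fmap F (fmap G f)).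

(** A monoidal structure on [C] with prescribed tensor [T] and unit [I] on
    objects. *)
Record Monoidal (C : Category) (T : C -> C -> C) (I : C) := {
  tensm : forall A A' B B' : C, Hom A A' -> Hom B B' -> Hom (T A B) (T A' B');
  assoc : forall A B E : C, Iso (T (T A B) E) (T A (T B E));
  lunit : forall A : C, Iso (T I A) A;
  runit : forall A : C, Iso (T A I) A;
  tensm_heq : forall A A' B B' : C,
    Proper (heq ==> heq ==> heq) (@tensm A A' B B');
  tensm_id : forall A B : C, tensm (idm A) (idm B) ≡ idm (T A B);
  tensm_comp : forall (A A' A'' B B' B'' : C)
      (f' : Hom A' A'') (f : Hom A A') (g' : Hom B' B'') (g : Hom B B'),
    tensm (f' ∘ f) (g' ∘ g) ≡ tensm f' g' ∘ tensm f g;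
  assoc_nat : forall (A A' B B' E E' : C)
      (f : Hom A A') (g : Hom B B') (h : Hom E E'),
    assoc A' B' E' ∘ tensm (tensm f g) h ≡ tensm f (tensm g h) ∘ assoc A B E;
  lunit_nat : forall (A A' : C) (f : Hom A A'),
    lunit A' ∘ tensm (idm I) f ≡ f ∘ lunit A;
  runit_nat : forall (A A' : C) (f : Hom A A'),
    runit A' ∘ tensm f (idm I) ≡ f ∘ runit A;
  triangle : forall A B : C,
    tensm (idm A) (lunit B) ∘ assoc A I B ≡ tensm (runit A) (idm B);
  pentagon : forall A B E F : C,
    assoc A B (T E F) ∘ assoc (T A B) E F ≡
    tensm (idm A) (assoc B E F) ∘ assoc A (T B E) F
      ∘ tensm (assoc A B E) (idm F) }.

#[export] Existing Instance tensm_heq.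

Record MonCat := {
  mcat :> Category;
  tens : mcat -> mcat -> mcat;
  munit : mcat;
  mstr :> Monoidal tens munit }.

Arguments tens {_} _ _.
Arguments munit {_}.

Notation "A ⊗ B" := (tens A B) (at level 35, right associativity) : cat_scope.
Notation "f ⊗₁ g" := (tensm (mstr _) f g) (at level 35, right associativity)
  : cat_scope.
Notation "'α'" := (assoc (mstr _)) (at level 0) : cat_scope.
Notation "'λ'" := (lunit (mstr _)) (at level 0) : cat_scope.
Notation "'ρ'" := (runit (mstr _)) (at level 0) : cat_scope.

Record MonFunctor (C D : MonCat) := {
  mfun :> Functor C D;
  mfun_tens : forall A B : C, Iso (mfun A ⊗ mfun B) (mfun (A ⊗ B));
  mfun_unit : Iso munit (mfun munit);
  mfun_nat : forall (A A' B B' : C) (f : Hom A A') (g : Hom B B'),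
    mfun_tens A' B' ∘ (fmap mfun f ⊗₁ fmap mfun g) ≡
    fmap mfun (f ⊗₁ g) ∘ mfun_tens A B;
  mfun_assoc : forall A B E : C,
    fmap mfun (α A B E) ∘ mfun_tens (A ⊗ B) E
      ∘ (mfun_tens A B ⊗₁ idm (mfun E)) ≡
    mfun_tens A (B ⊗ E) ∘ (idm (mfun A) ⊗₁ mfun_tens B E)
      ∘ α (mfun A) (mfun B) (mfun E);
  mfun_lunit : forall A : C,
    fmap mfun (λ A) ∘ mfun_tens munit A ∘ (mfun_unit ⊗₁ idm (mfun A)) ≡
    λ (mfun A);
  mfun_runit : forall A : C,
    fmap mfun (ρ A) ∘ mfun_tens A munit ∘ (idm (mfun A) ⊗₁ mfun_unit) ≡
    ρ (mfun A) }.

Definition mon_equiv (C D : MonCat) : Prop :=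
  exists F : MonFunctor C D, is_equivalence F.

(** Families are indexed by a type [J]; binary (phased) coproducts are those with
    [J := bool], finite ones those with [J] a [finType] (possibly empty). *)

Section Coproducts.
Variable C : Category.

Section Family.
Variables (J : Type) (A : J -> C) (X : C) (k : forall i, Hom (A i) X).

Definition is_coproduct : Prop :=
  forall (B : C) (f : forall i, Hom (A i) B),
    (exists h : Hom X B, forall i, h ∘ k i ≡ f i) /\
    (forall h h' : Hom X B, (forall i, h ∘ k i ≡ h' ∘ k i) -> h ≡ h').

Definition phase (U : Hom X X) : Prop := forall i, U ∘ k i ≡ k i.

Definition is_phased_coproduct : Prop :=
  (forall (B : C) (f : forall i, Hom (A i) B),
     exists h : Hom X B, forall i, h ∘ k i ≡ f i) /\
  (forall (B : C) (h h' : Hom X B), (forall i, h ∘ k i ≡ h' ∘ k i) ->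
     exists U : Hom X X, phase U /\ h' ≡ h ∘ U).

End Family.

Definition has_finite_coproducts : Prop :=
  forall (J : finType) (A : J -> C),
    exists (X : C) (k : forall i, Hom (A i) X), is_coproduct k.

Definition has_finite_phased_coproducts : Prop :=
  forall (J : finType) (A : J -> C),
    exists (X : C) (k : forall i, Hom (A i) X), is_phased_coproduct k.

Definition monic_finite_coproducts : Prop :=
  forall (J : finType) (A : J -> C) (X : C) (k : forall i, Hom (A i) X),
    is_coproduct k -> forall i, monic (k i).

Definition monic_finite_phased_coproducts : Prop :=
  forall (J : finType) (A : J -> C) (X : C) (k : forall i, Hom (A i) X),
    is_phased_coproduct k -> forall i, monic (k i).

Definition diagonal (A B : bool -> C) (X Y : C)
    (k : forall i, Hom (A i) X) (l : forall i, Hom (B i) Y) (f : Hom X Y) : Prop :=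
  forall i, exists g : Hom (A i) (B i), f ∘ k i ≡ l i ∘ g.

Definition transitive_phases : Prop :=
  forall (A B : bool -> C) (X Y : C)
      (k : forall i, Hom (A i) X) (l : forall i, Hom (B i) Y),
    is_phased_coproduct k -> is_phased_coproduct l ->
    forall (f : Hom X Y) (U : Hom X X), diagonal k l f -> phase k U ->
    exists V : Hom Y Y, phase l V /\ f ∘ U ≡ V ∘ f.

End Coproducts.

Definition preserves_coproducts (C D : Category) (F : Functor C D) : Prop :=
  forall (B : bool -> C) (X : C) (k : forall i, Hom (B i) X),
    is_coproduct k -> is_coproduct (fun i => fmap F (k i)).

Definition strongly_preserves_phased_coproducts (C D : Category)
    (F : Functor C D) : Prop :=
  forall (B : bool -> C) (X : C) (k : forall i, Hom (B i) X),
    is_phased_coproduct k ->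
    is_phased_coproduct (fun i => fmap F (k i)) /\
    forall W : Hom (F X) (F X), phase (fun i => fmap F (k i)) W ->
      exists U : Hom X X, phase k U /\ W ≡ fmap F U.

Section TensorFunctors.
Variables (C : MonCat) (A : C).

Fact tens_l_comp (B B' B'' : C) (g : Hom B' B'') (f : Hom B B') :
  idm A ⊗₁ (g ∘ f) ≡ (idm A ⊗₁ g) ∘ (idm A ⊗₁ f).
Proof. by rewrite -tensm_comp comp_idl. Qed.

Fact tens_r_comp (B B' B'' : C) (g : Hom B' B'') (f : Hom B B') :
  (g ∘ f) ⊗₁ idm A ≡ (g ⊗₁ idm A) ∘ (f ⊗₁ idm A).
Proof. by rewrite -tensm_comp comp_idl. Qed.

Definition tens_l : Functor C C := {|
  fob := fun B => A ⊗ B;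
  fmap := fun B B' f => idm A ⊗₁ f;
  fmap_heq := fun B B' f g fg => tensm_heq (mstr C) (reflexivity (idm A)) fg;
  fmap_id := fun B => tensm_id (mstr C) A B;
  fmap_comp := tens_l_comp |}.

Definition tens_r : Functor C C := {|
  fob := fun B => B ⊗ A;
  fmap := fun B B' f => f ⊗₁ idm A;
  fmap_heq := fun B B' f g fg => tensm_heq (mstr C) fg (reflexivity (idm A));
  fmap_id := fun B => tensm_id (mstr C) B A;
  fmap_comp := tens_r_comp |}.

End TensorFunctors.

Definition distributive_coproducts (D : MonCat) : Prop :=
  forall A : D, preserves_coproducts (tens_l A) /\ preserves_coproducts (tens_r A).

Definition distributive_phased_coproducts (C : MonCat) : Prop :=
  forall A : C, strongly_preserves_phased_coproducts (tens_l A) /\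
                strongly_preserves_phased_coproducts (tens_r A).

Record phased_side (C : MonCat) : Prop := {
  phs_has : has_finite_phased_coproducts C;
  phs_monic : monic_finite_phased_coproducts C;
  phs_distr : distributive_phased_coproducts C;
  phs_trans : transitive_phases C }.

Record coproduct_side (D : MonCat) : Prop := {
  cps_has : has_finite_coproducts D;
  cps_monic : monic_finite_coproducts D;
  cps_distr : distributive_coproducts D }.

Section Scalars.
Variable D : MonCat.
Implicit Types s t u : Hom (@munit D) munit.

Definition lscal (A B : D) s (f : Hom A B) : Hom A B :=
  λ B ∘ (s ⊗₁ f) ∘ bwd (λ A).

Definition rscal (A B : D) (f : Hom A B) s : Hom A B :=
  ρ B ∘ (f ⊗₁ s) ∘ bwd (ρ A).

Definition central s : Prop :=
  forall (A B : D) (f : Hom A B), lscal s f ≡ rscal f s.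

(** [P] is a set of scalars; being closed under (finite, possibly empty)
    composition, it contains the identity. *)
Record is_global_phases (P : Hom (@munit D) munit -> Prop) : Prop := {
  gph_heq : forall s t, s ≡ t -> P s -> P t;
  gph_inv : forall s, P s -> exists t, s ∘ t ≡ idm munit /\ t ∘ s ≡ idm munit;
  gph_central : forall s, P s -> central s;
  gph_id : P (idm munit);
  gph_comp : forall s t, P s -> P t -> P (s ∘ t);
  gph_closed_inv : forall s t, P s ->
    s ∘ t ≡ idm munit -> t ∘ s ≡ idm munit -> P t }.

End Scalars.

Section Coherence.
Variable D : MonCat.

Lemma iso_monic (A B : D) (i : Iso A B) : monic i.
Proof.
move=> X f g e.
by rewrite -(comp_idl f) -(comp_idl g) -(bwdK i) -!comp_assoc e.
Qed.

Lemma iso_epic (A B X : D) (i : Iso A B) (f g : Hom B X) :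
  f ∘ i ≡ g ∘ i -> f ≡ g.
Proof.
move=> e.
by rewrite -(comp_idr f) -(comp_idr g) -(fwdK i) !comp_assoc e.
Qed.

Lemma lunit_natb (A B : D) (f : Hom A B) :
  bwd (λ B) ∘ f ≡ (idm munit ⊗₁ f) ∘ bwd (λ A).
Proof.
apply: (iso_monic (i := λ B)).
by rewrite !comp_assoc fwdK lunit_nat comp_idl -comp_assoc fwdK comp_idr.
Qed.

Lemma runit_natb (A B : D) (f : Hom A B) :
  bwd (ρ B) ∘ f ≡ (f ⊗₁ idm munit) ∘ bwd (ρ A).
Proof.
apply: (iso_monic (i := ρ B)).
by rewrite !comp_assoc fwdK runit_nat comp_idl -comp_assoc fwdK comp_idr.
Qed.

Lemma tensm_Il_inj (A B : D) (f g : Hom A B) :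
  idm munit ⊗₁ f ≡ idm munit ⊗₁ g -> f ≡ g.
Proof.
by move=> e; apply: (iso_epic (i := λ A)); rewrite -!lunit_nat e.
Qed.

Lemma tensm_Ir_inj (A B : D) (f g : Hom A B) :
  f ⊗₁ idm munit ≡ g ⊗₁ idm munit -> f ≡ g.
Proof.
by move=> e; apply: (iso_epic (i := ρ A)); rewrite -!runit_nat e.
Qed.

Lemma tensm_iso_epic (A B E X : D) (i : Iso A B) (f g : Hom (B ⊗ E) X) :
  f ∘ (i ⊗₁ idm E) ≡ g ∘ (i ⊗₁ idm E) -> f ≡ g.
Proof.
move=> e.
have E1 : (i ⊗₁ idm E) ∘ (bwd i ⊗₁ idm E) ≡ idm (B ⊗ E).
  by rewrite -tensm_comp fwdK comp_idl tensm_id.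
by rewrite -(comp_idr f) -(comp_idr g) -E1 !comp_assoc e.
Qed.

Lemma lunit_tens (A B : D) : λ (A ⊗ B) ∘ α munit A B ≡ λ A ⊗₁ idm B.
Proof.
apply: tensm_Il_inj.
apply: (iso_epic (i := α _ _ _)); apply: (tensm_iso_epic (i := α _ _ _)).
transitivity ((idm munit ⊗₁ λ (A ⊗ B)) ∘
   ((idm munit ⊗₁ α munit A B) ∘ α munit (munit ⊗ A) B
      ∘ (α munit munit A ⊗₁ idm B))).
  by rewrite !comp_assoc -tensm_comp comp_idl.
rewrite -pentagon comp_assoc triangle -(tensm_id (mstr D) A B) -assoc_nat.
by rewrite -triangle -assoc_nat -comp_assoc -tensm_comp comp_idl.
Qed.

Lemma runit_tens (A B : D) : (idm A ⊗₁ ρ B) ∘ α A B munit ≡ ρ (A ⊗ B).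
Proof.
apply: tensm_Ir_inj; apply: (iso_monic (i := α A B munit)).
transitivity (α A B munit ∘ ((idm A ⊗₁ ρ B) ⊗₁ idm munit)
                ∘ (α A B munit ⊗₁ idm munit)).
  by rewrite -comp_assoc -tensm_comp comp_idl.
rewrite assoc_nat -triangle.
transitivity ((idm A ⊗₁ (idm B ⊗₁ λ munit)) ∘
   ((idm A ⊗₁ α B munit munit) ∘ α A (B ⊗ munit) munit
      ∘ (α A B munit ⊗₁ idm munit))).
  by rewrite !comp_assoc -tensm_comp comp_idl.
rewrite -pentagon comp_assoc -assoc_nat tensm_id -comp_assoc.
by rewrite triangle.
Qed.

End Coherence.

Section ScalarLemmas.
Variable D : MonCat.
Implicit Types s t u : Hom (@munit D) munit.

#[export] Instance lscal_heq (A B : D) :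
  Proper (heq ==> heq ==> heq) (@lscal D A B).
Proof. by move=> s t st f g fg; rewrite /lscal st fg. Qed.

Lemma lscal_id (A B : D) (f : Hom A B) : lscal (idm munit) f ≡ f.
Proof. by rewrite /lscal lunit_nat -comp_assoc fwdK comp_idr. Qed.

Lemma lscal_comp s t (A B E : D) (g : Hom B E) (f : Hom A B) :
  lscal s g ∘ lscal t f ≡ lscal (s ∘ t) (g ∘ f).
Proof.
rewrite /lscal tensm_comp !comp_assoc.
by rewrite -(comp_assoc _ (bwd (λ B))) bwdK comp_idr.
Qed.

Lemma lscal_lscal s t (A B : D) (f : Hom A B) :
  lscal s (lscal t f) ≡ lscal (s ∘ t) f.
Proof.
have lscalE (g : Hom A B) : lscal s g ≡ lscal s (idm B) ∘ g.
  by rewrite -{2}(lscal_id g) lscal_comp comp_idl comp_idr.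
by rewrite lscalE lscal_comp comp_idl.
Qed.

Lemma lscal_tensl s (A A' B B' : D) (f : Hom A A') (g : Hom B B') :
  lscal s f ⊗₁ g ≡ lscal s (f ⊗₁ g).
Proof.
have eA : bwd (λ A) ⊗₁ idm B ≡ bwd (α munit A B) ∘ bwd (λ (A ⊗ B)).
  apply: (tensm_iso_epic (i := λ A)).
  rewrite -tensm_comp bwdK comp_idl tensm_id -lunit_tens comp_assoc.
  by rewrite -(comp_assoc _ (bwd (λ _))) bwdK comp_idr bwdK.
transitivity ((λ A' ⊗₁ idm B') ∘ ((s ⊗₁ f) ⊗₁ g) ∘ (bwd (λ A) ⊗₁ idm B)).
  by rewrite -!tensm_comp comp_idl comp_idr.
rewrite eA -lunit_tens /lscal !comp_assoc.
rewrite -(comp_assoc (λ _) (α _ _ _)) assoc_nat !comp_assoc.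
by rewrite -(comp_assoc _ (α _ _ _)) fwdK comp_idr.
Qed.

Lemma rscal_tensr s (A A' B B' : D) (f : Hom A A') (g : Hom B B') :
  f ⊗₁ rscal g s ≡ rscal (f ⊗₁ g) s.
Proof.
transitivity ((idm A' ⊗₁ ρ B') ∘ (f ⊗₁ (g ⊗₁ s)) ∘ (idm A ⊗₁ bwd (ρ B))).
  by rewrite -!tensm_comp comp_idl comp_idr.
rewrite /rscal -runit_tens -(comp_assoc _ (α _ _ _)) assoc_nat -!comp_assoc.
do 2 apply: comp_heq => //.
apply: (iso_epic (i := ρ (A ⊗ B))).
rewrite -comp_assoc bwdK comp_idr -runit_tens comp_assoc -tensm_comp.
by rewrite bwdK comp_idl tensm_id comp_idl.
Qed.

End ScalarLemmas.

(** The category [D_P]: same objects and morphisms as [D], with [f] and [g]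
    identified when [f = u · g] for some [u] in [P]. *)
Section Quotient.
Variables (D : MonCat) (P : Hom (@munit D) munit -> Prop).
Hypothesis HP : is_global_phases P.

Definition qeq (A B : D) (f g : Hom A B) : Prop :=
  exists u, P u /\ f ≡ lscal u g.

Fact heq_qeq (A B : D) (f g : Hom A B) : f ≡ g -> qeq f g.
Proof. by exists (idm munit); split; [apply: gph_id | rewrite lscal_id]. Qed.

Fact qeq_equiv (A B : D) : Equivalence (@qeq A B).
Proof.
split.
- by move=> f; apply: heq_qeq.
- move=> f g [u [Pu e]]; have [t [ut tu]] := gph_inv HP Pu.
  exists t; split; first exact: gph_closed_inv Pu ut tu.
  by rewrite e lscal_lscal tu lscal_id.
- move=> f g h [u [Pu e]] [v [Pv e']]; exists (u ∘ v).
  by split; [apply: gph_comp | rewrite e e' lscal_lscal].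
Qed.

Fact qeq_comp (A B E : D) :
  Proper (@qeq B E ==> @qeq A B ==> @qeq A E) (@comp D A B E).
Proof.
move=> g g' [u [Pu e]] f f' [v [Pv e']]; exists (u ∘ v).
by split; [apply: gph_comp | rewrite e e' lscal_comp].
Qed.

Fact qeq_tensm (A A' B B' : D) :
  Proper (@qeq A A' ==> @qeq B B' ==> @qeq (A ⊗ B) (A' ⊗ B'))
    (@tensm _ _ _ (mstr D) A A' B B').
Proof.
move=> f f' [u [Pu e]] g g' [v [Pv e']]; exists (u ∘ v).
split; first exact: gph_comp.
rewrite e e' lscal_tensl (gph_central HP Pv) rscal_tensr.
by rewrite -(gph_central HP Pv) lscal_lscal.
Qed.

Definition quotient_cat : Category := {|
  Obj := D;
  Hom := @Hom D;
  heq := qeq;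
  idm := @idm D;
  comp := @comp D;
  heq_equiv := qeq_equiv;
  comp_heq := qeq_comp;
  comp_assoc := fun A B E F h g f => heq_qeq (comp_assoc h g f);
  comp_idl := fun A B f => heq_qeq (comp_idl f);
  comp_idr := fun A B f => heq_qeq (comp_idr f) |}.

Definition quotient_iso (A B : D) (i : Iso A B) : @Iso quotient_cat A B :=
  @Build_Iso quotient_cat A B (fwd i) (bwd i)
    (heq_qeq (bwdK i)) (heq_qeq (fwdK i)).

Definition quotient_monoidal : @Monoidal quotient_cat (@tens D) munit :=
  let M := mstr D in
  @Build_Monoidal quotient_cat (@tens D) munit
    (@tensm _ _ _ M)
    (fun A B E => quotient_iso (assoc M A B E))
    (fun A => quotient_iso (lunit M A))
    (fun A => quotient_iso (runit M A))
    qeq_tensm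
    (fun A B => heq_qeq (tensm_id M A B))
    (fun A A' A'' B B' B'' f' f g' g => heq_qeq (tensm_comp M f' f g' g))
    (fun A A' B B' E E' f g h => heq_qeq (assoc_nat M f g h))
    (fun A A' f => heq_qeq (lunit_nat M f))
    (fun A A' f => heq_qeq (runit_nat M f))
    (fun A B => heq_qeq (triangle M A B))
    (fun A B E F => heq_qeq (pentagon M A B E F)).

Definition quotient : MonCat := Build_MonCat quotient_monoidal.

End Quotient.

(** Equivalence of monoidal categories with chosen global phases: the monoidal
    equivalence must identify the two choices of global phases. *)
Definition gph_equiv (D : MonCat) (P : Hom (@munit D) munit -> Prop)
    (D' : MonCat) (P' : Hom (@munit D') munit -> Prop) : Prop :=
  exists F : MonFunctor D D', is_equivalence F /\
    forall s : Hom (@munit D) munit,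
      P s <-> P' (bwd (mfun_unit F) ∘ fmap F s ∘ mfun_unit F).

Section GP.
Variable C : MonCat.

Definition pair (A B : C) : bool -> C := fun b => if b then A else B.

Definition copair (A B X : C) (f : Hom A X) (g : Hom B X) :
    forall b : bool, Hom (pair A B b) X :=
  fun b => match b with true => f | false => g end.

Record UnitSum (A : C) := {
  us_ob : C;
  us_in : Hom A us_ob;
  us_unit : Hom munit us_ob;
  us_phased : is_phased_coproduct (copair us_in us_unit) }.

Record GPOb := {
  gp_base : C;
  gp_sum : UnitSum gp_base }.

Definition gp_ob (A : GPOb) : C := us_ob (gp_sum A).
Definition gp_in (A : GPOb) : Hom (gp_base A) (gp_ob A) := us_in (gp_sum A).
Definition gp_unit (A : GPOb) : Hom munit (gp_ob A) := us_unit (gp_sum A).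
Definition gp_coproj (A : GPOb) := copair (gp_in A) (gp_unit A).

Record GPHom (A B : GPOb) := {
  gp_hom :> Hom (gp_ob A) (gp_ob B);
  gp_diag : diagonal (gp_coproj A) (gp_coproj B) gp_hom;
  gp_fix : gp_hom ∘ gp_unit A ≡ gp_unit B }.

Fact gp_id_diag (A : GPOb) :
  diagonal (gp_coproj A) (gp_coproj A) (idm (gp_ob A)).
Proof. by move=> i; exists (idm _); rewrite comp_idl comp_idr. Qed.

Definition gp_id (A : GPOb) : GPHom A A :=
  Build_GPHom (gp_id_diag A) (comp_idl (gp_unit A)).

Fact gp_comp_diag (A B E : GPOb) (g : GPHom B E) (f : GPHom A B) :
  diagonal (gp_coproj A) (gp_coproj E) (g ∘ f).
Proof.
move=> i; have [f0 e] := gp_diag f i; have [g0 e'] := gp_diag g i.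
by exists (g0 ∘ f0); rewrite -comp_assoc e comp_assoc e' comp_assoc.
Qed.

Fact gp_comp_fix (A B E : GPOb) (g : GPHom B E) (f : GPHom A B) :
  g ∘ f ∘ gp_unit A ≡ gp_unit E.
Proof. by rewrite -comp_assoc !gp_fix. Qed.

Definition gp_comp (A B E : GPOb) (g : GPHom B E) (f : GPHom A B) : GPHom A E :=
  Build_GPHom (gp_comp_diag g f) (gp_comp_fix g f).

Definition gp_eq (A B : GPOb) (f g : GPHom A B) : Prop := gp_hom f ≡ gp_hom g.

Fact gp_eq_equiv (A B : GPOb) : Equivalence (@gp_eq A B).
Proof.
split; rewrite /gp_eq.
- by [].
- by move=> f g e; rewrite e.
- by move=> f g h e e'; rewrite e e'.
Qed.

Fact gp_eq_comp (A B E : GPOb) :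
  Proper (@gp_eq B E ==> @gp_eq A B ==> @gp_eq A E) (@gp_comp A B E).
Proof. by rewrite /gp_eq => g g' e f f' e' /=; rewrite e e'. Qed.

Definition GPCat : Category := {|
  Obj := GPOb;
  Hom := GPHom;
  heq := gp_eq;
  idm := gp_id;
  comp := gp_comp;
  heq_equiv := gp_eq_equiv;
  comp_heq := gp_eq_comp;
  comp_assoc := fun A B E F h g f =>
    comp_assoc (gp_hom h) (gp_hom g) (gp_hom f);
  comp_idl := fun A B f => comp_idl (gp_hom f);
  comp_idr := fun A B f => comp_idr (gp_hom f) |}.

(** The data chosen to define the monoidal structure.  That [beta ∘ κ₂ = κ₂]
    is part of [beta] being a morphism of [GPCat]. *)
Record GPChoice := {
  gp_tens_sum : forall A B : GPOb, UnitSum (gp_base A ⊗ gp_base B);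
  gp_tens := fun A B : GPOb => Build_GPOb (gp_tens_sum A B);
  gp_c : forall A B : GPOb, Hom (gp_ob (gp_tens A B)) (gp_ob A ⊗ gp_ob B);
  gp_c_in : forall A B : GPOb,
    gp_c A B ∘ gp_in (gp_tens A B) ≡ gp_in A ⊗₁ gp_in B;
  gp_c_unit : forall A B : GPOb,
    gp_c A B ∘ gp_unit (gp_tens A B) ≡
    (gp_unit A ⊗₁ gp_unit B) ∘ bwd (ρ munit);
  gp_I_sum : UnitSum munit;
  gp_I := Build_GPOb gp_I_sum;
  gp_beta : @Iso GPCat (gp_tens gp_I gp_I) gp_I;
  gp_beta_in : gp_hom (fwd gp_beta) ∘ gp_in (gp_tens gp_I gp_I) ≡ gp_in gp_I ∘ ρ munit }.

(** The equivalences say that the given morphism is the only solution of the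
    equation: the monoidal structure is determined by the choice [ch]. *)
Record is_gp_monoidal (ch : GPChoice)
    (M : @Monoidal GPCat (gp_tens ch) (gp_I ch)) : Prop := {
  gpm_tensm : forall (A A' B B' : GPOb) (f : GPHom A A') (g : GPHom B B')
      (h : Hom (gp_ob (gp_tens ch A B)) (gp_ob (gp_tens ch A' B'))),
    gp_c ch A' B' ∘ h ≡ (gp_hom f ⊗₁ gp_hom g) ∘ gp_c ch A B <->
    h ≡ gp_hom (tensm M f g);
  gpm_assoc : forall (A B E : GPOb)
      (h : Hom (gp_ob (gp_tens ch (gp_tens ch A B) E))
               (gp_ob (gp_tens ch A (gp_tens ch B E)))),
    (idm (gp_ob A) ⊗₁ gp_c ch B E) ∘ gp_c ch A (gp_tens ch B E) ∘ h ≡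
    α (gp_ob A) (gp_ob B) (gp_ob E) ∘ (gp_c ch A B ⊗₁ idm (gp_ob E))
      ∘ gp_c ch (gp_tens ch A B) E <->
    h ≡ gp_hom (fwd (assoc M A B E));
  gpm_runit : forall (A : GPOb) (r : GPHom (gp_tens ch A (gp_I ch)) A),
    tensm M r (gp_id (gp_I ch)) ≡
    tensm M (gp_id A) (gp_beta ch) ∘ assoc M A (gp_I ch) (gp_I ch) <->
    runit M A ≡ r;
  gpm_lunit : forall (A : GPOb) (l : GPHom (gp_tens ch (gp_I ch) A) A),
    tensm M (gp_id (gp_I ch)) l ≡
    tensm M (gp_beta ch) (gp_id A) ∘ bwd (assoc M (gp_I ch) (gp_I ch) A) <->
    lunit M A ≡ l }.

Record GP := {
  gp_choice : GPChoice;
  gp_monoidal : @Monoidal GPCat (gp_tens gp_choice) (gp_I gp_choice);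
  gp_spec : is_gp_monoidal gp_monoidal }.

Definition GPMon (G : GP) : MonCat := Build_MonCat (gp_monoidal G).

Definition gp_phases (G : GP) (u : Hom (@munit (GPMon G)) munit) : Prop :=
  phase (gp_coproj (gp_I (gp_choice G))) (gp_hom u).

End GP.

Coercion GPMon : GP >-> MonCat.

(* Main.v *)
(** The tensor unit generates all phases: since [Z ⊗ -] and [- ⊗ Z] strongly preserve
    phased coproducts, every phase of [A ∔ Z] is induced, through the monomorphism
    [A ∔ Z -> (A ∔ I) ⊗ Z] given by a point of [Z], by a phase of [A ∔ I], and
    every phase of [A ∔ I] is induced by one of [I ∔ I].  The first fact gives the
    uniqueness half of the universal property of [(A ∔ B) ∔ I] as a coproduct of
    [A ∔ I] and [B ∔ I] in [GP(C)], transitivity of phases gives the existence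
    half; the second fact says that two morphisms of [GP(C)] with the same base
    differ by a global phase.  Hence the base functor [GP(C) -> C] is full,
    essentially surjective and identifies exactly the morphisms that differ by a
    global phase.

    Conversely a monoidal functor [K : D -> C] with these three properties (for
    the phases [P]) induces [D_P ≃ C], and [A |-> K (A + I)] is an equivalence
    [D ≃ GP(C)] that respects the global phases.  All parts of the theorem apply
    this to a suitable [K]: the base functor, the projection [D -> D_P], and their
    composites with equivalences. *)
From mathcomp Require Import all_boot.
From Stdlib Require Import Setoid Morphisms IndefiniteDescription.
Require Import Defs.

Set Implicit Arguments.
Unset Strict Implicit.
Unset Printing Implicit Defensive.

Local Open Scope cat_scope.

#[local] Hint Extern 0 (heq _ _) => reflexivity : core.
#[local] Notation cid := (@constructive_indefinite_description _ _).

(** Legs determine a morphism out of a phased coproduct only up to a phase, so diagrams in [GP C]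
    cannot be checked on coprojections. Uniqueness comes from monomorphisms instead. The main one is
    [gp_c]: by distributivity [(A ∔ I) ⊗ (B ∔ I)] is an iterated phased coproduct of [A ⊗ B],
    [A ⊗ I], [I ⊗ B] and [I ⊗ I], and [gp_c] includes the first and the last. Rebracketing turns
    such a partial inclusion into a composite of coprojections, up to a phase. It stays monic under
    tensoring, so equations of [GP C] are checked in [C] after composing with it. Existence follows
    one pattern: take a morphism with the right legs, observe that the desired equation holds up to
    a phase, and absorb that phase, moving it along a diagonal morphism by transitivity when it sits
    on the wrong object. In the unitors of [GP C] and in the unit constraint of the functor into it,
    the same correction is made by a phase of a tensor factor or by a scalar. *)

#[local] Instance and3_iff : Proper (iff ==> iff ==> iff ==> iff) and3.
Proof. by move=> P P' p Q Q' q R R' r; split=> -[]; split; tauto. Qed.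

#[local] Instance and4_iff : Proper (iff ==> iff ==> iff ==> iff ==> iff) and4.
Proof. by move=> P P' p Q Q' q R R' r S S' s; split=> -[]; split; tauto. Qed.

(** * Phased coproducts of two objects *)

Section Categories.
Variable C : Category.

Lemma heq_refl (A B : C) (f : Hom A B) : f ≡ f.
Proof. by []. Qed.

Lemma heq_sym (A B : C) (f g : Hom A B) : f ≡ g -> g ≡ f.
Proof. by move=> ->. Qed.

Lemma heq_trans (A B : C) (f g h : Hom A B) : f ≡ g -> g ≡ h -> f ≡ h.
Proof. by move=> ->. Qed.

(** In composites associated to the left, [g ∘ f] is no longer a subterm once [x] follows [g]; in
    this form the equation still rewrites. *)
Lemma comp_tail (A B E : C) (g : Hom B E) (f : Hom A B) (h : Hom A E) :
  g ∘ f ≡ h -> forall (Y : C) (x : Hom E Y), x ∘ g ∘ f ≡ x ∘ h.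
Proof. by move=> e Y x; rewrite -comp_assoc e. Qed.

Definition invertible (A B : C) (f : Hom A B) : Prop :=
  exists g : Hom B A, g ∘ f ≡ idm A /\ f ∘ g ≡ idm B.

Lemma iso_invertible (A B : C) (i : Iso A B) : invertible i.
Proof. by exists (bwd i); split; [apply: bwdK | apply: fwdK]. Qed.

Lemma iso_inv_invertible (A B : C) (i : Iso A B) : invertible (bwd i).
Proof. by exists i; split; [apply: fwdK | apply: bwdK]. Qed.

Lemma invertible_iso (A B : C) (f : Hom A B) :
  invertible f -> exists i : Iso A B, fwd i = f.
Proof. by case=> g [gf fg]; exists (Build_Iso gf fg). Qed.

Lemma invertible_id (A : C) : invertible (idm A).
Proof. by exists (idm A); rewrite comp_idl. Qed.

Lemma invertible_heq (A B : C) (f g : Hom A B) :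
  f ≡ g -> invertible f -> invertible g.
Proof. by move=> e [f' [a b]]; exists f'; rewrite -e. Qed.

Lemma invertible_lr (A B : C) (f : Hom A B) (g h : Hom B A) :
  g ∘ f ≡ idm A -> f ∘ h ≡ idm B -> invertible f.
Proof.
move=> gf fh; exists g; split=> //.
have -> : g ≡ h by rewrite -(comp_idr g) -fh comp_assoc gf comp_idl.
by [].
Qed.

Lemma invertible_monic (A B : C) (f : Hom A B) : invertible f -> monic f.
Proof.
move=> [f' [f'f _]] X g h e.
by rewrite -(comp_idl g) -(comp_idl h) -f'f -!comp_assoc e.
Qed.

Lemma invertible_epic (A B X : C) (f : Hom A B) (g h : Hom B X) :
  invertible f -> g ∘ f ≡ h ∘ f -> g ≡ h.
Proof.
move=> [f' [_ ff']] e.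
by rewrite -(comp_idr g) -(comp_idr h) -ff' !comp_assoc e.
Qed.

Lemma iso_move_r (A B X : C) (i : Iso A B) (g : Hom B X) (h : Hom A X) :
  g ∘ i ≡ h <-> g ≡ h ∘ bwd i.
Proof.
by split=> [<-|->]; rewrite -comp_assoc ?fwdK ?bwdK comp_idr.
Qed.

Lemma iso_move_l (A B X : C) (i : Iso A B) (g : Hom X A) (h : Hom X B) :
  i ∘ g ≡ h <-> g ≡ bwd i ∘ h.
Proof.
by split=> [<-|->]; rewrite comp_assoc ?fwdK ?bwdK comp_idl.
Qed.

Lemma monic_comp (A B E : C) (g : Hom B E) (f : Hom A B) :
  monic g -> monic f -> monic (g ∘ f).
Proof. by move=> mg mf X a b; rewrite -!comp_assoc => /mg /mf. Qed.

Lemma monic_heq (A B : C) (f g : Hom A B) : f ≡ g -> monic f -> monic g.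
Proof. by move=> e mf X a b; rewrite -!e => /mf. Qed.

(** The [bool]-indexed notion with its family unpacked, so that each leg can be composed and
    rewritten separately. *)
Definition phased2 (A B X : C) (i : Hom A X) (j : Hom B X) : Prop :=
  (forall (T : C) (f : Hom A T) (g : Hom B T),
     exists h : Hom X T, h ∘ i ≡ f /\ h ∘ j ≡ g) /\
  (forall (T : C) (h h' : Hom X T), h ∘ i ≡ h' ∘ i -> h ∘ j ≡ h' ∘ j ->
     exists U : Hom X X, [/\ U ∘ i ≡ i, U ∘ j ≡ j & h' ≡ h ∘ U]).

Definition coproduct2 (A B X : C) (i : Hom A X) (j : Hom B X) : Prop :=
  (forall (T : C) (f : Hom A T) (g : Hom B T),
     exists h : Hom X T, h ∘ i ≡ f /\ h ∘ j ≡ g) /\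
  (forall (T : C) (h h' : Hom X T), h ∘ i ≡ h' ∘ i -> h ∘ j ≡ h' ∘ j -> h ≡ h').

Lemma phased2P (A : bool -> C) (X : C) (k : forall b, Hom (A b) X) :
  is_phased_coproduct k <-> phased2 (k true) (k false).
Proof.
split=> -[ex un]; split.
- move=> T f g.
  have [h e] := ex T (fun b => match b with true => f | false => g end).
  by exists h; split; [apply: (e true) | apply: (e false)].
- move=> T h h' e1 e2; have [|U [pU eU]] := un T h h'; first by case.
  by exists U; split; first exact: (pU true); first exact: (pU false).
- move=> T f; have [h [e1 e2]] := ex T (f true) (f false).
  by exists h; case.
- move=> T h h' e; have [U [p1 p2 eU]] := un T h h' (e true) (e false).
  by exists U; split=> //; case.
Qed.

Lemma coproduct2P (A : bool -> C) (X : C) (k : forall b, Hom (A b) X) :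
  is_coproduct k <-> coproduct2 (k true) (k false).
Proof.
split.
- move=> cop; split.
  + move=> T f g; have [[h e] _] :=
      cop T (fun b => match b with true => f | false => g end).
    by exists h; split; [apply: (e true) | apply: (e false)].
  + move=> T h h' e1 e2; have [_ un] := cop T (fun b => h ∘ k b).
    by apply: un; case.
- move=> [ex un] T f; split=> [|h h' e]; last exact: un.
  by have [h [e1 e2]] := ex T (f true) (f false); exists h; case.
Qed.

Lemma phased2_sym (A B X : C) (i : Hom A X) (j : Hom B X) :
  phased2 i j -> phased2 j i.
Proof.
move=> [ex un]; split=> [T f g|T h h' e1 e2].
  by have [h [e1 e2]] := ex T g f; exists h.
by have [U [p1 p2 eU]] := un T h h' e2 e1; exists U.
Qed.

Lemma phased2_heq (A B X : C) (i i' : Hom A X) (j j' : Hom B X) :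
  i ≡ i' -> j ≡ j' -> phased2 i j -> phased2 i' j'.
Proof.
move=> ei ej [ex un]; split=> [T f g|T h h'].
  by have [h [e1 e2]] := ex T f g; exists h; rewrite -ei -ej.
move=> e1 e2; have [||U [p1 p2 eU]] := un T h h'; rewrite ?ei ?ej //.
by exists U; split=> //; rewrite -?ei -?ej.
Qed.

Lemma phased2_iso (A B X Y : C) (i : Hom A X) (j : Hom B X) (f : Hom X Y) :
  invertible f -> phased2 i j -> phased2 (f ∘ i) (f ∘ j).
Proof.
move=> [f' [f'f ff']] [ex un]; split=> [T g g'|T h h'].
  have [h [e1 e2]] := ex T g g'; exists (h ∘ f').
  by rewrite !comp_assoc (comp_tail f'f) comp_idr.
move=> e1 e2; have [||U [p1 p2 eU]] := un T (h ∘ f) (h' ∘ f);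
  rewrite -?comp_assoc //.
exists (f ∘ U ∘ f'); split.
- by rewrite comp_assoc (comp_tail f'f) comp_idr (comp_tail p1).
- by rewrite comp_assoc (comp_tail f'f) comp_idr (comp_tail p2).
- by rewrite !comp_assoc -eU (comp_tail ff') comp_idr.
Qed.

Lemma phased2_iso_in (A B A' B' X : C) (i : Hom A X) (j : Hom B X)
    (a : Hom A' A) (b : Hom B' B) :
  invertible a -> invertible b -> phased2 i j -> phased2 (i ∘ a) (j ∘ b).
Proof.
move=> ia ib [ex un]; split=> [T g g'|T h h'].
  have [a' [a'a _]] := ia; have [b' [b'b _]] := ib.
  have [h [e1 e2]] := ex T (g ∘ a') (g' ∘ b'); exists h.
  by rewrite !comp_assoc e1 e2 (comp_tail a'a) (comp_tail b'b) !comp_idr.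
move=> e1 e2; have [||U [p1 p2 eU]] := un T h h'.
- by apply: (invertible_epic ia); rewrite -!comp_assoc.
- by apply: (invertible_epic ib); rewrite -!comp_assoc.
by exists U; rewrite !comp_assoc p1 p2.
Qed.

(** As [U] and the identity agree on the legs, [idm X ≡ U ∘ V] for a phase [V]. So every phase has a
    right inverse that is a phase, and applying this to [V] makes the inverse two-sided. *)
Lemma phase_invertible (A B X : C) (i : Hom A X) (j : Hom B X) (U : Hom X X) :
  phased2 i j -> U ∘ i ≡ i -> U ∘ j ≡ j ->
  exists V, [/\ V ∘ i ≡ i, V ∘ j ≡ j, U ∘ V ≡ idm X & V ∘ U ≡ idm X].
Proof.
move=> [_ un] Ui Uj.
have [||V [Vi Vj eV]] := un X U (idm X); rewrite ?comp_idl //.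
have [||W [Wi Wj eW]] := un X V (idm X); rewrite ?comp_idl //.
have UW : U ≡ W by rewrite -(comp_idr U) eW comp_assoc -eV comp_idl.
by exists V; split=> //; [rewrite -eV | rewrite UW -eW].
Qed.

Lemma phased2_compare (A B X Y : C) (i : Hom A X) (j : Hom B X)
    (i' : Hom A Y) (j' : Hom B Y) (f : Hom X Y) :
  phased2 i j -> phased2 i' j' -> f ∘ i ≡ i' -> f ∘ j ≡ j' -> invertible f.
Proof.
move=> pX pY fi fj; have [g [gi gj]] := (proj1 pY) X i j.
have [||V [_ _ _ eV]] := phase_invertible (U := g ∘ f) pX.
- by rewrite -comp_assoc fi.
- by rewrite -comp_assoc fj.
have [||W [_ _ eW _]] := phase_invertible (U := f ∘ g) pY.
- by rewrite -comp_assoc gi.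
- by rewrite -comp_assoc gj.
apply: (invertible_lr (g := V ∘ g) (h := g ∘ W)).
- by rewrite -comp_assoc.
- by rewrite comp_assoc.
Qed.

(** An endomorphism of [(A ∔ B) ∔ E] fixing the three summands need not fix [k], but it satisfies
    [U ∘ k ≡ k ∘ T] for a phase [T] of [A ∔ B]. Composing with a map that undoes [T] gives a true
    phase, hence a right inverse of the same kind. *)
Lemma nested_phase_invertible (A B E X Y : C) (i : Hom A X) (j : Hom B X)
    (k : Hom X Y) (l : Hom E Y) (U : Hom Y Y) :
  phased2 i j -> phased2 k l ->
  U ∘ k ∘ i ≡ k ∘ i -> U ∘ k ∘ j ≡ k ∘ j -> U ∘ l ≡ l -> invertible U.
Proof.
move=> pX pY.
have rinv V : V ∘ k ∘ i ≡ k ∘ i -> V ∘ k ∘ j ≡ k ∘ j -> V ∘ l ≡ l ->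
    exists W, [/\ V ∘ W ≡ idm Y, W ∘ k ∘ i ≡ k ∘ i, W ∘ k ∘ j ≡ k ∘ j
                & W ∘ l ≡ l].
  move=> Vi Vj Vl.
  have [||T [Ti Tj eT]] := (proj2 pX) Y k (V ∘ k); rewrite ?Vi ?Vj //.
  have [T' [T'i T'j TT' _]] := phase_invertible pX Ti Tj.
  have [W [Wk Wl]] := (proj1 pY) Y (k ∘ T') l.
  have [||Z [Zk Zl VWZ _]] := phase_invertible (U := V ∘ W) pY.
  - by rewrite -comp_assoc Wk comp_assoc eT (comp_tail TT') comp_idr.
  - by rewrite -comp_assoc Wl.
  exists (W ∘ Z); split.
  - by rewrite comp_assoc.
  - by rewrite (comp_tail Zk) Wk (comp_tail T'i).
  - by rewrite (comp_tail Zk) Wk (comp_tail T'j).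
  - by rewrite (comp_tail Zl) Wl.
move=> Ui Uj Ul; have [V [UV Vi Vj Vl]] := rinv U Ui Uj Ul.
have [W [VW _ _ _]] := rinv V Vi Vj Vl.
have UW : U ≡ W by rewrite -(comp_idr U) -VW comp_assoc UV comp_idl.
by exists V; split=> //; rewrite UW.
Qed.

(** Rebracketing [(A ∔ B) ∔ E] as [(A ∔ E) ∔ B]. The comparison maps with a given phased coproduct
    [Y'] of [Z] and [B] have composites that fix only the three innermost legs, hence the appeal to
    [nested_phase_invertible]. *)
Lemma phased2_assoc (A B E X Y Z : C) (i : Hom A X) (j : Hom B X)
    (k : Hom X Y) (l : Hom E Y) (m : Hom A Z) (n : Hom E Z) (r : Hom Z Y) :
  (exists (Y' : C) (k' : Hom Z Y') (l' : Hom B Y'), phased2 k' l') ->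
  phased2 i j -> phased2 k l -> phased2 m n -> r ∘ m ≡ k ∘ i -> r ∘ n ≡ l ->
  phased2 r (k ∘ j).
Proof.
move=> [Y' [k' [l' pY']]] pX pY pZ rm rn.
have [f [fk fl]] := (proj1 pY') Y r (k ∘ j).
have [q [qi qj]] := (proj1 pX) Y' (k' ∘ m) l'.
have [g [gk gl]] := (proj1 pY) Y' q (k' ∘ n).
apply: (phased2_heq fk fl); apply: phased2_iso => //.
have [|||a [_ Ea]] := nested_phase_invertible (U := f ∘ g) pX pY.
- by rewrite (comp_tail gk) (comp_tail qi) comp_assoc fk.
- by rewrite (comp_tail gk) (comp_tail qj).
- by rewrite (comp_tail gl) comp_assoc fk.
have [|||b [Eb _]] := nested_phase_invertible (U := g ∘ f) pZ pY'.
- by rewrite (comp_tail fk) (comp_tail rm) comp_assoc gk.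
- by rewrite (comp_tail fk) (comp_tail rn).
- by rewrite (comp_tail fl) comp_assoc gk.
apply: (invertible_lr (g := b ∘ g) (h := g ∘ a)).
- by rewrite -comp_assoc.
- by rewrite comp_assoc.
Qed.

End Categories.

(** * Equivalences and finite coproducts *)

Section Equivalences.
Variables (C D : Category) (F : Functor C D).

Definition full : Prop :=
  forall (A B : C) (g : Hom (F A) (F B)), exists f : Hom A B, fmap F f ≡ g.

Definition faithful : Prop :=
  forall (A B : C) (f f' : Hom A B), fmap F f ≡ fmap F f' -> f ≡ f'.

Definition essentially_surjective : Prop :=
  forall X : D, exists A : C, inhabited (Iso (F A) X).

Lemma equivalence_intro :
  full -> faithful -> essentially_surjective -> is_equivalence F.
Proof.
move=> fu fa es.
have pre (X : D) : {A : C & Iso (F A) X}.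
  have [A i] := cid (es X); exists A.
  have /cid[//] : exists i : Iso (F A) X, True by case: i => i; exists i.
pose G X := projT1 (pre X); pose e X : Iso (F (G X)) X := projT2 (pre X).
pose lift A B g := sval (cid (fu A B g)).
have liftE A B g : fmap F (lift A B g) ≡ g := svalP (cid (fu A B g)).
pose Gm X Y (f : Hom X Y) := lift (G X) (G Y) (bwd (e Y) ∘ f ∘ e X).
have GmE X Y (f : Hom X Y) : fmap F (Gm X Y f) ≡ bwd (e Y) ∘ f ∘ e X.
  exact: liftE.
have Gh X Y : Proper (heq ==> heq) (Gm X Y).
  by move=> f f' ff'; apply: fa; rewrite !GmE ff'.
have Gi X : Gm X X (idm X) ≡ idm (G X).
  by apply: fa; rewrite GmE fmap_id comp_idr bwdK.
have Gc X Y Z (g : Hom Y Z) (f : Hom X Y) :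
    Gm X Z (g ∘ f) ≡ Gm Y Z g ∘ Gm X Y f.
  apply: fa; rewrite fmap_comp !GmE !comp_assoc (comp_tail (fwdK (e Y))).
  by rewrite comp_idr.
pose GF := Build_Functor Gh Gi Gc.
exists GF; split; last first.
  exists e => X Y f /=.
  by rewrite GmE !comp_assoc fwdK comp_idl.
have etab A : lift (G (F A)) A (e (F A)) ∘ lift A (G (F A)) (bwd (e (F A)))
    ≡ idm A.
  by apply: fa; rewrite fmap_comp !liftE fwdK fmap_id.
have etaf A : lift A (G (F A)) (bwd (e (F A))) ∘ lift (G (F A)) A (e (F A))
    ≡ idm (G (F A)).
  by apply: fa; rewrite fmap_comp !liftE bwdK fmap_id.
exists (fun A => @Build_Iso C (GF (F A)) A _ _ (etaf A) (etab A)) => A B f /=.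
apply: fa; rewrite !fmap_comp !liftE !comp_assoc fwdK comp_idl.
by [].
Qed.

Lemma equivalence_faithful : is_equivalence F -> faithful.
Proof.
move=> [G [[eta etaN] _]] A B f f' e.
apply: (invertible_epic (iso_invertible (eta A))).
by rewrite !etaN e.
Qed.

Lemma equivalence_essentially_surjective :
  is_equivalence F -> essentially_surjective.
Proof. by move=> [G [_ [e _]]] X; exists (G X); split; exact: (e X). Qed.

End Equivalences.

Lemma equivalence_full (C D : Category) (F : Functor C D) :
  is_equivalence F -> full F.
Proof.
move=> eF A B g; have := eF; move=> [G [[eta etaN] [e eN]]].
have faG : faithful G.
  move=> X Y f f' E; apply: (invertible_epic (iso_invertible (e X))).
  by rewrite !eN E.
exists (eta B ∘ fmap G g ∘ bwd (eta A)); apply: faG.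
apply: (invertible_monic (iso_invertible (eta B))).
by rewrite -etaN -comp_assoc bwdK comp_idr.
Qed.

Section FiniteCoproducts.
Variable C : Category.

Definition initial (O : C) : Prop :=
  forall T : C, (exists f : Hom O T, True) /\ forall f g : Hom O T, f ≡ g.

Hypothesis hasinit : exists O : C, initial O.
Hypothesis has2 : forall A B : C,
  exists (X : C) (i : Hom A X) (j : Hom B X), coproduct2 i j.

Lemma finite_coproducts_of_binary : has_finite_coproducts C.
Proof.
move=> J A.
(* Legs take a membership proof, so that the induction can add one summand at a time; without
   repetitions the new summand is not among the old ones. *)
suff main (s : seq J) : uniq s ->
    exists (X : C) (k : forall i, i \in s -> Hom (A i) X),
    forall (B : C) (f : forall i, i \in s -> Hom (A i) B),
    (exists h : Hom X B, forall i (si : i \in s), h ∘ k i si ≡ f i si) /\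
    (forall h h' : Hom X B,
      (forall i (si : i \in s), h ∘ k i si ≡ h' ∘ k i si) -> h ≡ h').
  have [X [k cop]] := main (enum J) (enum_uniq J).
  exists X, (fun i => k i (mem_enum J i)) => B f.
  have [[h e] un] := cop B (fun i _ => f i).
  split; first by exists h.
  move=> h1 h2 e12; apply: un => i si.
  by rewrite (bool_irrelevance si (mem_enum J i)).
elim: s => [_|a s IH].
  have [O init] := hasinit; exists O, (fun i (si : i \in [::]) =>
    False_rect _ (notF si)) => B f.
  have [[h _] un] := init B; split; first by exists h.
  by move=> *; apply: un.
move=> /andP[as_ us]; have [X [k cop]] := IH us.
have [Y [l [m [ex un]]]] := has2 (A a) X.
have sub i (si : i \in a :: s) : i <> a -> i \in s.
  by move: si; rewrite inE; case: eqP.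
(* [Hom (A i) Y] and [Hom (A a) Y] agree only along [i = a], hence the transport. Equality proofs in
   [J] are unique, which removes it in [KaE]. *)
pose K i (si : i \in a :: s) : Hom (A i) Y :=
  match i =P a with
  | ReflectT e => match esym e in _ = i return Hom (A i) Y with erefl => l end
  | ReflectF ne => m ∘ k i (sub i si ne)
  end.
have KaE (sa : a \in a :: s) : K a sa ≡ l.
  by rewrite /K; case: eqP => // e; rewrite (eq_axiomK e).
have KsE i (si : i \in a :: s) (si' : i \in s) : K i si ≡ m ∘ k i si'.
  rewrite /K; case: eqP => [e|ne].
    by exfalso; rewrite e (negPf as_) in si'.
  by rewrite (bool_irrelevance (sub _ _ _) si').
exists Y, K => B f; split.
  have [[h0 e0] _] := cop B (fun i si => f i (mem_behead (s := a :: s) si)).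
  have [h [el em]] := ex B (f a (mem_head a s)) h0.
  exists h => i si; have [e|ne] := eqVneq i a.
    subst i; rewrite KaE el.
    by rewrite (bool_irrelevance si (mem_head a s)).
  move/eqP in ne; rewrite (KsE i si (sub i si ne)) comp_assoc em e0.
  by rewrite (bool_irrelevance (mem_behead _) si).
move=> h h' e; apply: un.
  by have := e a (mem_head a s); rewrite KaE.
have [_ un'] := cop B (fun i si => h ∘ m ∘ k i si).
apply: un' => i si; have := e i (mem_behead (s := a :: s) si).
by rewrite (KsE _ _ si) !comp_assoc.
Qed.

(** Each [k i] is a leg of a binary coproduct whose other summand is the coproduct [R] of the
    remaining objects. *)
Lemma monic_finite_coproducts_of_binary :
  (forall (A B X : C) (i : Hom A X) (j : Hom B X), coproduct2 i j -> monic i) ->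
  monic_finite_coproducts C.
Proof.
move=> mon J A X k cop i.
have [R [r copR]] := finite_coproducts_of_binary
  (J := {j : J | j != i}) (fun j => A (val j)).
have [[q qr] _] := copR X (fun j => k (val j)).
apply: (mon _ _ _ _ q); split.
- move=> T f g.
  have neq j : j <> i -> j != i by move/eqP.
  pose F (j : J) : Hom (A j) T :=
    match j =P i with
    | ReflectT e => match esym e in _ = j return Hom (A j) T with erefl => f end
    | ReflectF ne => g ∘ r (exist _ j (neq j ne))
    end.
  have [[h eh] _] := cop T F; exists h; split.
    rewrite eh /F; case: eqP => // e; by rewrite (eq_axiomK e).
  have [_ un] := copR T (fun j => g ∘ r j); apply: un => j.
  rewrite -comp_assoc qr eh /F; case: j => j nej /=; case: eqP => [e|ne].
    by exfalso; move: nej; rewrite e eqxx.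
  by rewrite (bool_irrelevance (neq j ne) nej).
- move=> T h h' ei eq; have [_ un] := cop T (fun j => h ∘ k j).
  apply: un => j; have [->//|ne] := eqVneq j i.
  have := qr (exist _ j ne) => /= <-.
  by rewrite !comp_assoc eq.
Qed.

End FiniteCoproducts.

Lemma binary_coproduct (C : Category) (A B : C) : has_finite_coproducts C ->
  exists (X : C) (i : Hom A X) (j : Hom B X), coproduct2 i j.
Proof.
move=> has; have [X [k cop]] := has bool (fun b => if b then A else B).
by exists X, (k true), (k false); exact: (proj1 (coproduct2P k) cop).
Qed.

(** * Monoidal categories and their units *)

Section MonoidalLemmas.
Variable C : MonCat.

Lemma comp_tensm (A A' A'' B B' B'' Y : C) (f' : Hom A' A'') (f : Hom A A')
    (g' : Hom B' B'') (g : Hom B B') (x : Hom (A'' ⊗ B'') Y) :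
  x ∘ (f' ⊗₁ g') ∘ (f ⊗₁ g) ≡ x ∘ ((f' ∘ f) ⊗₁ (g' ∘ g)).
Proof. by rewrite -comp_assoc -tensm_comp. Qed.

Lemma tensm_split_l (A A' B B' : C) (f : Hom A A') (g : Hom B B') :
  f ⊗₁ g ≡ (f ⊗₁ idm B') ∘ (idm A ⊗₁ g).
Proof. by rewrite -tensm_comp comp_idl comp_idr. Qed.

Lemma tensm_split_r (A A' B B' : C) (f : Hom A A') (g : Hom B B') :
  f ⊗₁ g ≡ (idm A' ⊗₁ g) ∘ (f ⊗₁ idm B).
Proof. by rewrite -tensm_comp comp_idl comp_idr. Qed.

Lemma tensm_invertible (A A' B B' : C) (f : Hom A A') (g : Hom B B') :
  invertible f -> invertible g -> invertible (f ⊗₁ g).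
Proof.
move=> [f' [a b]] [g' [c d]]; exists (f' ⊗₁ g').
by rewrite -!tensm_comp a b c d !tensm_id.
Qed.

(** By [triangle] and [lunit_tens] it is enough that [idm munit ⊗₁ λ munit] equals
    [λ (munit ⊗ munit)], which is naturality of [λ] at [λ munit]. *)
Lemma lunit_runit : λ (@munit C) ≡ ρ munit.
Proof.
apply: tensm_Ir_inj; rewrite -triangle -lunit_tens; apply: comp_heq => //.
by apply: (iso_monic (i := λ munit)); rewrite lunit_nat.
Qed.

Lemma lunit_runitb : bwd (λ (@munit C)) ≡ bwd (ρ munit).
Proof.
apply: (iso_monic (i := λ munit)); rewrite fwdK.
transitivity (ρ munit ∘ bwd (ρ (@munit C))); first by rewrite fwdK.
by rewrite lunit_runit.
Qed.

(** The monoidal product of two points; [gp_c] takes this value on the unit summand. *)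
Definition point_tens (A B : C) (x : Hom munit A) (y : Hom munit B) :
  Hom munit (A ⊗ B) := (x ⊗₁ y) ∘ bwd (ρ munit).

Lemma tens_point (A B A' B' : C) (f : Hom A A') (g : Hom B B')
    (x : Hom munit A) (y : Hom munit B) :
  (f ⊗₁ g) ∘ point_tens x y ≡ point_tens (f ∘ x) (g ∘ y).
Proof. by rewrite /point_tens comp_assoc -tensm_comp. Qed.

#[export] Instance point_tens_heq (A B : C) :
  Proper (heq ==> heq ==> heq) (@point_tens A B).
Proof. by move=> x x' e y y' e'; rewrite /point_tens e e'. Qed.

Lemma assoc_point (A B E : C) (x : Hom munit A) (y : Hom munit B)
    (z : Hom munit E) :
  α A B E ∘ point_tens (point_tens x y) z ≡ point_tens x (point_tens y z).
Proof.
have eI : α munit munit munit ∘ (bwd (ρ munit) ⊗₁ idm munit) ≡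
    idm munit ⊗₁ bwd (ρ (@munit C)).
  apply: (tensm_iso_epic (i := ρ munit)).
  rewrite -comp_assoc -tensm_comp bwdK comp_idl tensm_id comp_idr.
  rewrite -triangle comp_assoc -tensm_comp comp_idl.
  by rewrite lunit_runit bwdK tensm_id comp_idl.
rewrite /point_tens -[z]comp_idr tensm_comp !comp_assoc assoc_nat.
rewrite -(comp_assoc _ (α _ _ _)) eI -tensm_comp.
by rewrite !comp_idr.
Qed.

(** With [point_tens_lunit] it yields two factorisations of one point, the gluing condition for the
    pairing [a] in [gp_copair_uniq]. *)
Lemma point_tens_runit (A B : C) (x : Hom munit A) (y : Hom munit B) :
  point_tens x y ≡ (idm A ⊗₁ y) ∘ bwd (ρ A) ∘ x.
Proof. by rewrite -comp_assoc runit_natb comp_assoc -tensm_split_r. Qed.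

Lemma point_tens_lunit (A B : C) (x : Hom munit A) (y : Hom munit B) :
  point_tens x y ≡ (x ⊗₁ idm B) ∘ bwd (λ B) ∘ y.
Proof.
by rewrite -comp_assoc lunit_natb comp_assoc -tensm_split_l lunit_runitb.
Qed.

End MonoidalLemmas.

(** J. Kock, "Elementary remarks on units in monoidal categories": an object [I]
    with an isomorphism [I ⊗ I -> I], such that tensoring with [I] is faithful
    and the unitors exist, is a monoidal unit. *)
Section Units.
Variables (C : Category) (T : C -> C -> C) (I : C).
Variable tm : forall A A' B B' : C,
  Hom A A' -> Hom B B' -> Hom (T A B) (T A' B').
Variable al : forall A B E : C, Iso (T (T A B) E) (T A (T B E)).
Arguments tm {_ _ _ _} _ _.
Arguments al : clear implicits.
Local Notation "f ⊠ g" := (tm f g) (at level 35, right associativity).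
Hypothesis tm_heq : forall A A' B B' : C,
  Proper (heq ==> heq ==> heq) (@tm A A' B B').
Hypothesis tm_id : forall A B : C, idm A ⊠ idm B ≡ idm (T A B).
Hypothesis tm_comp : forall (A A' A'' B B' B'' : C)
  (f' : Hom A' A'') (f : Hom A A') (g' : Hom B' B'') (g : Hom B B'),
  (f' ∘ f) ⊠ (g' ∘ g) ≡ (f' ⊠ g') ∘ (f ⊠ g).
Hypothesis al_nat : forall (A A' B B' E E' : C)
  (f : Hom A A') (g : Hom B B') (h : Hom E E'),
  al A' B' E' ∘ ((f ⊠ g) ⊠ h) ≡ (f ⊠ (g ⊠ h)) ∘ al A B E.
Hypothesis al_pentagon : forall A B E F : C,
  al A B (T E F) ∘ al (T A B) E F ≡
  (idm A ⊠ al B E F) ∘ al A (T B E) F ∘ (al A B E ⊠ idm F).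
Variable beta : Iso (T I I) I.
Hypothesis r_inj : forall (A B : C) (f g : Hom A B),
  f ⊠ idm I ≡ g ⊠ idm I -> f ≡ g.
Hypothesis l_inj : forall (A B : C) (f g : Hom A B),
  idm I ⊠ f ≡ idm I ⊠ g -> f ≡ g.
Hypothesis r_ex : forall A : C, exists r : Iso (T A I) A,
  r ⊠ idm I ≡ (idm A ⊠ beta) ∘ al A I I.
Hypothesis l_ex : forall A : C, exists l : Iso (T I A) A,
  idm I ⊠ l ≡ (beta ⊠ idm A) ∘ bwd (al I I A).

#[local] Existing Instance tm_heq.

Definition unit_r (A : C) : Iso (T A I) A := sval (cid (r_ex A)).
Definition unit_l (A : C) : Iso (T I A) A := sval (cid (l_ex A)).

Lemma unit_rE (A : C) : unit_r A ⊠ idm I ≡ (idm A ⊠ beta) ∘ al A I I.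
Proof. exact: svalP (cid (r_ex A)). Qed.

Lemma unit_lE (A : C) : idm I ⊠ unit_l A ≡ (beta ⊠ idm A) ∘ bwd (al I I A).
Proof. exact: svalP (cid (l_ex A)). Qed.

Lemma unit_r_nat (A A' : C) (f : Hom A A') :
  unit_r A' ∘ (f ⊠ idm I) ≡ f ∘ unit_r A.
Proof.
apply: r_inj; rewrite -(comp_idl (idm I)) !tm_comp (comp_idl (idm I)) !unit_rE.
rewrite -comp_assoc al_nat comp_assoc tm_id -tm_comp comp_idl comp_idr.
by rewrite comp_assoc -tm_comp comp_idl comp_idr.
Qed.

Lemma al_natb (A A' B B' E E' : C) (f : Hom A A') (g : Hom B B')
    (h : Hom E E') :
  bwd (al A' B' E') ∘ (f ⊠ (g ⊠ h)) ≡ ((f ⊠ g) ⊠ h) ∘ bwd (al A B E).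
Proof.
by symmetry; apply/iso_move_l; rewrite comp_assoc; symmetry; apply/iso_move_r;
   rewrite al_nat.
Qed.

Lemma unit_l_nat (A A' : C) (f : Hom A A') :
  unit_l A' ∘ (idm I ⊠ f) ≡ f ∘ unit_l A.
Proof.
apply: l_inj; rewrite -(comp_idl (idm I)) !tm_comp (comp_idl (idm I)) !unit_lE.
rewrite -comp_assoc al_natb comp_assoc tm_id -tm_comp comp_idl comp_idr.
by rewrite comp_assoc -tm_comp comp_idl comp_idr.
Qed.

(** The auxiliary [K] is the triangle identity for [A ⊗ I] and [B]; as it is
    invertible, it can be cancelled from the identity for [A] and [B]. *)
Lemma unit_triangle (A B : C) :
  (idm A ⊠ unit_l B) ∘ al A I B ≡ unit_r A ⊠ idm B.
Proof.
have K : (unit_r A ⊠ idm I) ⊠ idm B ≡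
    (idm (T A I) ⊠ unit_l B) ∘ al (T A I) I B.
  apply: (invertible_monic (iso_invertible (al A I B))).
  transitivity ((idm A ⊠ (idm I ⊠ unit_l B)) ∘ al A I (T I B)
                  ∘ al (T A I) I B); last by rewrite -al_nat tm_id -comp_assoc.
  rewrite unit_lE -comp_assoc al_pentagon !comp_assoc -tm_comp.
  rewrite (comp_tail (bwdK _)) !comp_idr -al_nat -comp_assoc -tm_comp.
  by rewrite -unit_rE comp_idr.
have iK : invertible ((unit_r A ⊠ idm I) ⊠ idm B).
  have inv X Y Z (f : Hom X Y) : invertible f -> invertible (f ⊠ idm Z).
    move=> [g [gf fg]]; exists (g ⊠ idm Z).
    by rewrite -!tm_comp gf fg !comp_idl !tm_id.
  by apply/inv/inv/iso_invertible.
apply: (invertible_epic iK).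
rewrite -comp_assoc al_nat comp_assoc -tm_comp comp_idl tm_id comp_idr.
rewrite K comp_assoc -tm_comp comp_idl comp_idr.
by rewrite -[in X in X ⊠ _](comp_idr (unit_r A)) -(comp_idl (unit_l B)) tm_comp.
Qed.

Definition units_monoidal : Monoidal T I := {|
  tensm := @tm;
  assoc := al;
  lunit := unit_l;
  runit := unit_r;
  tensm_heq := tm_heq;
  tensm_id := tm_id;
  tensm_comp := tm_comp;
  assoc_nat := al_nat;
  lunit_nat := unit_l_nat;
  runit_nat := unit_r_nat;
  triangle := unit_triangle;
  pentagon := al_pentagon |}.

End Units.

(** * Phased coproducts with a unit summand *)

Section PhasedSide.
Variable C : MonCat.
Hypothesis HC : phased_side C.

Lemma phased2_ex (A B : C) :
  exists (X : C) (i : Hom A X) (j : Hom B X), phased2 i j.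
Proof.
have [X [k ph]] := phs_has HC (J := bool) (pair A B).
by exists X, (k true), (k false); exact: (proj1 (phased2P k) ph).
Qed.

Lemma phased2_copair (A B X : C) (i : Hom A X) (j : Hom B X) :
  phased2 i j -> is_phased_coproduct (copair i j).
Proof. exact: (proj2 (phased2P (copair i j))). Qed.

Lemma phased2_monic (A B X : C) (i : Hom A X) (j : Hom B X) :
  phased2 i j -> monic i.
Proof.
by move=> /phased2_copair ph; exact: (@phs_monic C HC bool _ _ _ ph true).
Qed.

Lemma phased2_trans (A B A' B' X Y : C) (i : Hom A X) (j : Hom B X)
    (i' : Hom A' Y) (j' : Hom B' Y) (f : Hom X Y) (g : Hom A A') (h : Hom B B')
    (U : Hom X X) :
  phased2 i j -> phased2 i' j' -> f ∘ i ≡ i' ∘ g -> f ∘ j ≡ j' ∘ h ->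
  U ∘ i ≡ i -> U ∘ j ≡ j ->
  exists V, [/\ V ∘ i' ≡ i', V ∘ j' ≡ j' & f ∘ U ≡ V ∘ f].
Proof.
move=> /phased2_copair pX /phased2_copair pY fi fj Ui Uj.
have [||V [pV e]] := phs_trans HC pX pY (f := f) (U := U).
- by case; [exists g | exists h].
- by case.
by exists V; split=> //; [exact: (pV true) | exact: (pV false)].
Qed.

Lemma phased2_tens_l (E A B X : C) (i : Hom A X) (j : Hom B X) :
  phased2 i j -> phased2 (idm E ⊗₁ i) (idm E ⊗₁ j) /\
    forall W : Hom (E ⊗ X) (E ⊗ X),
      W ∘ (idm E ⊗₁ i) ≡ idm E ⊗₁ i -> W ∘ (idm E ⊗₁ j) ≡ idm E ⊗₁ j ->
      exists U : Hom X X, [/\ U ∘ i ≡ i, U ∘ j ≡ j & W ≡ idm E ⊗₁ U].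
Proof.
move=> /phased2_copair pX; have [ph st] := (phs_distr HC E).1 _ _ _ pX.
split; first exact: (proj1 (phased2P _) ph).
move=> W Wi Wj; have [|U [pU eU]] := st W; first by case.
by exists U; split=> //; [exact: (pU true) | exact: (pU false)].
Qed.

Lemma phased2_tens_r (E A B X : C) (i : Hom A X) (j : Hom B X) :
  phased2 i j -> phased2 (i ⊗₁ idm E) (j ⊗₁ idm E) /\
    forall W : Hom (X ⊗ E) (X ⊗ E),
      W ∘ (i ⊗₁ idm E) ≡ i ⊗₁ idm E -> W ∘ (j ⊗₁ idm E) ≡ j ⊗₁ idm E ->
      exists U : Hom X X, [/\ U ∘ i ≡ i, U ∘ j ≡ j & W ≡ U ⊗₁ idm E].
Proof.
move=> /phased2_copair pX; have [ph st] := (phs_distr HC E).2 _ _ _ pX.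
split; first exact: (proj1 (phased2P _) ph).
move=> W Wi Wj; have [|U [pU eU]] := st W; first by case.
by exists U; split=> //; [exact: (pU true) | exact: (pU false)].
Qed.

(** Stronger than [monic], to make composites such as [(A ⊗ c) ∘ c] monic. *)
Definition tens_monic (A B : C) (m : Hom A B) : Prop :=
  forall E : C, monic (idm E ⊗₁ m).

Lemma tens_monic_monic (A B : C) (m : Hom A B) : tens_monic m -> monic m.
Proof.
move=> mm X f g e; apply: tensm_Il_inj; apply: mm.
by rewrite -!tensm_comp e.
Qed.

Lemma tens_monic_comp (A B E : C) (g : Hom B E) (f : Hom A B) :
  tens_monic g -> tens_monic f -> tens_monic (g ∘ f).
Proof.
move=> mg mf F; apply: (@monic_heq _ _ _ ((idm F ⊗₁ g) ∘ (idm F ⊗₁ f))).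
  by rewrite -tensm_comp comp_idl.
exact: monic_comp.
Qed.

Lemma tens_monic_heq (A B : C) (f g : Hom A B) :
  f ≡ g -> tens_monic f -> tens_monic g.
Proof.
by move=> e mf F; apply: (@monic_heq _ _ _ (idm F ⊗₁ f)) => //; rewrite e.
Qed.

Lemma tens_monic_invertible (A B : C) (f : Hom A B) :
  invertible f -> tens_monic f.
Proof.
by move=> fi E; apply/invertible_monic/tensm_invertible => //;
   exact: invertible_id.
Qed.

(** The associator identifies [F ⊗ (E ⊗ m)] with [(F ⊗ E) ⊗ m]. *)
Lemma tens_monic_tens (E A B : C) (m : Hom A B) :
  tens_monic m -> tens_monic (idm E ⊗₁ m).
Proof.
move=> mm F X f g e.
apply: (invertible_monic (iso_inv_invertible (α F E A))).
apply: (mm (F ⊗ E)); apply: (iso_monic (i := α F E B)).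
by rewrite !comp_assoc -(tensm_id (mstr C)) assoc_nat (comp_tail (fwdK _)) comp_idr.
Qed.

Lemma phased2_tens_monic (A B X : C) (i : Hom A X) (j : Hom B X) :
  phased2 i j -> tens_monic i.
Proof. by move=> pX E; apply: phased2_monic (phased2_tens_l E pX).1. Qed.

(** Dropping the middle summand [B] of [(A ∔ B) ∔ E]: after rebracketing, the inclusion [r] is
    itself a coprojection, with [B] as the other summand. *)
Lemma phased2_half_monic (A B E X Y Z : C) (i : Hom A X) (j : Hom B X)
    (k : Hom X Y) (l : Hom E Y) (m : Hom A Z) (n : Hom E Z) (r : Hom Z Y) :
  phased2 i j -> phased2 k l -> phased2 m n -> r ∘ m ≡ k ∘ i -> r ∘ n ≡ l ->
  tens_monic r.
Proof.
move=> pX pY pZ rm rn; apply: phased2_tens_monic.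
exact: (phased2_assoc (phased2_ex _ _) pX pY pZ rm rn).
Qed.

Implicit Types A B : GPOb C.

Lemma gp_phased A : phased2 (gp_in A) (gp_unit A).
Proof. exact: (proj1 (phased2P _) (us_phased (gp_sum A))). Qed.

Lemma gp_in_monic A : monic (gp_in A).
Proof. exact: phased2_monic (gp_phased A). Qed.

(** [diagonal] only asserts that a component exists, so one is chosen; it is unique up to [≡]
    because [gp_in] is monic. *)
Definition gp_basem A B (f : GPHom A B) : Hom (gp_base A) (gp_base B) :=
  sval (cid (gp_diag f true)).

Lemma gp_basemE A B (f : GPHom A B) :
  f ∘ gp_in A ≡ gp_in B ∘ gp_basem f.
Proof. exact: svalP (cid (gp_diag f true)). Qed.

Lemma gp_basem_uniq A B (f : GPHom A B) g :
  f ∘ gp_in A ≡ gp_in B ∘ g -> gp_basem f ≡ g.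
Proof. by rewrite gp_basemE; apply: gp_in_monic. Qed.

Lemma gp_basem_id A : gp_basem (gp_id A) ≡ idm (gp_base A).
Proof. by apply: gp_basem_uniq; rewrite comp_idl comp_idr. Qed.

Lemma gp_basem_comp A B E (g : GPHom B E) (f : GPHom A B) :
  gp_basem (gp_comp g f) ≡ gp_basem g ∘ gp_basem f.
Proof.
apply: gp_basem_uniq => /=.
by rewrite -comp_assoc gp_basemE comp_assoc gp_basemE comp_assoc.
Qed.

Lemma gp_basem_heq A B (f g : GPHom A B) :
  gp_hom f ≡ gp_hom g -> gp_basem f ≡ gp_basem g.
Proof. by move=> e; apply: gp_basem_uniq; rewrite e gp_basemE. Qed.

Fact gp_mk_diag A B (h : Hom (gp_ob A) (gp_ob B)) g :
  h ∘ gp_in A ≡ gp_in B ∘ g -> h ∘ gp_unit A ≡ gp_unit B ->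
  diagonal (gp_coproj A) (gp_coproj B) h.
Proof.
by move=> e1 e2 [] /=; [exists g | exists (idm munit); rewrite comp_idr].
Qed.

Definition gp_mk A B (h : Hom (gp_ob A) (gp_ob B)) g
    (e1 : h ∘ gp_in A ≡ gp_in B ∘ g) (e2 : h ∘ gp_unit A ≡ gp_unit B) :
  GPHom A B := Build_GPHom (gp_mk_diag e1 e2) e2.

(** A morphism [h] with the required legs gives [m ∘ h] equal to [p] up to a phase of [A], which [h]
    then absorbs. With [gp_c] or [gp_cr] as [m] this produces the tensor of morphisms and the
    associator. *)
Lemma gp_lift A B (T : C) (m : Hom (gp_ob B) T) (p : Hom (gp_ob A) T)
    (g : Hom (gp_base A) (gp_base B)) :
  m ∘ gp_in B ∘ g ≡ p ∘ gp_in A -> m ∘ gp_unit B ≡ p ∘ gp_unit A ->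
  exists h : GPHom A B, m ∘ h ≡ p /\ gp_basem h ≡ g.
Proof.
move=> e1 e2; have [h [h1 h2]] := (gp_phased A).1 _ (gp_in B ∘ g) (gp_unit B).
have [||U [U1 U2 eU]] := (gp_phased A).2 T (m ∘ h) p.
- by rewrite -comp_assoc h1 comp_assoc.
- by rewrite -comp_assoc h2.
have k1 : h ∘ U ∘ gp_in A ≡ gp_in B ∘ g by rewrite (comp_tail U1).
have k2 : h ∘ U ∘ gp_unit A ≡ gp_unit B by rewrite (comp_tail U2).
by exists (gp_mk k1 k2); rewrite /= comp_assoc -eU; split=> //;
  apply: gp_basem_uniq.
Qed.

Lemma gp_full A B (g : Hom (gp_base A) (gp_base B)) :
  exists h : GPHom A B, gp_basem h ≡ g.
Proof.
have [h [h1 h2]] := (gp_phased A).1 _ (gp_in B ∘ g) (gp_unit B).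
by exists (gp_mk h1 h2); apply: gp_basem_uniq.
Qed.

Definition gp_phase A (U : GPHom A A) : Prop := gp_basem U ≡ idm (gp_base A).

Lemma gp_phase_mk A (U : Hom (gp_ob A) (gp_ob A)) :
  U ∘ gp_in A ≡ gp_in A -> U ∘ gp_unit A ≡ gp_unit A ->
  exists V : GPHom A A, gp_hom V = U /\ gp_phase V.
Proof.
move=> U1 U2; have U1' : U ∘ gp_in A ≡ gp_in A ∘ idm _ by rewrite comp_idr.
by exists (gp_mk U1' U2); split=> //; apply: gp_basem_uniq.
Qed.

Lemma gp_phase_in A (U : GPHom A A) : gp_phase U -> U ∘ gp_in A ≡ gp_in A.
Proof. by move=> e; rewrite gp_basemE e comp_idr. Qed.

Lemma gp_phase_diff_r A B (h h' : GPHom A B) : gp_basem h ≡ gp_basem h' ->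
  exists U : GPHom A A, gp_phase U /\ gp_hom h' ≡ h ∘ U.
Proof.
move=> e; have [||U [U1 U2 eU]] := (gp_phased A).2 _ h h'.
- by rewrite !gp_basemE e.
- by rewrite !gp_fix.
by have [V [VU pV]] := gp_phase_mk U1 U2; exists V; rewrite VU.
Qed.

(** Transitivity carries the phase of [gp_phase_diff_r] across [h]. *)
Lemma gp_phase_diff_l A B (h h' : GPHom A B) : gp_basem h ≡ gp_basem h' ->
  exists U : GPHom B B, gp_phase U /\ gp_hom h' ≡ U ∘ h.
Proof.
move=> /gp_phase_diff_r [U [pU eU]].
have [||V [V1 V2 eV]] := phased2_trans (f := h) (g := gp_basem h)
  (h := idm munit) (gp_phased A) (gp_phased B) _ _ (gp_phase_in pU) (gp_fix U).
- exact: gp_basemE.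
- by rewrite comp_idr gp_fix.
by have [W [WV pW]] := gp_phase_mk V1 V2; exists W; rewrite WV -eV.
Qed.

(** Composites with a lift of the inverse of the base are phases, and phases are invertible. *)
Lemma gp_invertible A B (f : GPHom A B) :
  invertible (gp_basem f) -> @invertible (GPCat C) A B f.
Proof.
move=> [g0 [gf fg]]; have [g eg] := gp_full g0.
have inv E (U : GPHom E E) : gp_phase U -> exists V : GPHom E E,
    U ∘ V ≡ idm (gp_ob E) /\ V ∘ U ≡ idm (gp_ob E).
  move=> /gp_phase_in U1.
  have [V [V1 V2 UV VU]] := phase_invertible (gp_phased E) U1 (gp_fix U).
  by have [W [WV _]] := gp_phase_mk V1 V2; exists W; rewrite WV.
have [|V [_ VE]] := inv A (gp_comp g f).
  by rewrite /gp_phase gp_basem_comp eg gf.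
have [|W [EW _]] := inv B (gp_comp f g).
  by rewrite /gp_phase gp_basem_comp eg fg.
apply: (@invertible_lr (GPCat C) _ _ f (gp_comp V g) (gp_comp g W)).
- by rewrite /= /gp_eq /= -comp_assoc.
- by rewrite /= /gp_eq /= comp_assoc.
Qed.

Lemma gp_invertible_base A B (f : GPHom A B) :
  @invertible (GPCat C) A B f -> invertible (gp_basem f).
Proof.
move=> [g [a b]]; exists (gp_basem g); rewrite -!gp_basem_comp.
by split; rewrite -gp_basem_id; apply: gp_basem_heq.
Qed.

End PhasedSide.

(** * The monoidal structure of GP *)

Section GPTensor.
Variable C : MonCat.
Hypothesis HC : phased_side C.

Lemma gp_c_exists (A B : GPOb C)
    (S : UnitSum (gp_base A ⊗ gp_base B)) (AB := Build_GPOb S) :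
  exists c : Hom (gp_ob AB) (gp_ob A ⊗ gp_ob B),
    c ∘ gp_in AB ≡ gp_in A ⊗₁ gp_in B /\
    c ∘ gp_unit AB ≡ (gp_unit A ⊗₁ gp_unit B) ∘ bwd (ρ munit).
Proof. exact: (gp_phased AB).1. Qed.

Lemma unit_sum_exists (A : C) : inhabited (UnitSum A).
Proof.
have [X [i [j ph]]] := phased2_ex HC A munit.
exact: (inhabits (Build_UnitSum (phased2_copair ph))).
Qed.

Lemma gp_choice_exists : inhabited (GPChoice C).
Proof.
have US (A : C) : UnitSum A.
  by have /cid[] : exists S : UnitSum A, True
    by have [S] := unit_sum_exists A; exists S.
pose S (A B : GPOb C) : UnitSum (gp_base A ⊗ gp_base B) := US _.
pose c A B := sval (cid (gp_c_exists (S A B))).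
have cE A B := svalP (cid (gp_c_exists (S A B))).
pose I := Build_GPOb (US (@munit C)).
have [b eb] := gp_full HC (A := Build_GPOb (S I I)) (B := I) (ρ munit).
have [|beta ebeta] := @invertible_iso (GPCat C) _ _ b.
  apply: gp_invertible => //.
  by apply: (invertible_heq _ (iso_invertible (ρ munit))); rewrite eb.
apply: (inhabits (@Build_GPChoice _ S c _ _ (US munit) beta _)).
- by move=> A B; exact: (cE A B).1.
- by move=> A B; exact: (cE A B).2.
- by rewrite ebeta gp_basemE eb.
Qed.

Variable ch : GPChoice C.
Local Notation "A ⊗̂ B" := (gp_tens ch A B) (at level 35, right associativity).
Local Notation c := (gp_c ch).
Local Notation I := (gp_I ch).
Local Notation β := (gp_beta ch).
Implicit Types A B E F : GPOb C.

Lemma gp_c_point A B :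
  c A B ∘ gp_unit (A ⊗̂ B) ≡ point_tens (gp_unit A) (gp_unit B).
Proof. exact: gp_c_unit. Qed.

(** Two summands are dropped in turn: [r] includes [(A ⊗ B) ∔ (I ⊗ (B ∔ I))], missing [A ⊗ I], and
    [s] includes [(A ⊗ B) ∔ I] in that, missing [I ⊗ B]. On legs [c A B] agrees with [r ∘ s], so
    they differ by an invertible phase. *)
Lemma gp_c_tens_monic A B : tens_monic (c A B).
Proof.
have pA : phased2 (idm (gp_base A) ⊗₁ gp_in B) (idm (gp_base A) ⊗₁ gp_unit B).
  exact: (phased2_tens_l HC (gp_base A) (gp_phased B)).1.
have pI : phased2 ((idm munit ⊗₁ gp_unit B) ∘ bwd (ρ munit))
                  ((idm munit ⊗₁ gp_in B) ∘ idm _).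
  apply: phased2_iso_in; [exact: iso_inv_invertible | exact: invertible_id |].
  by apply: phased2_sym; exact: (phased2_tens_l HC munit (gp_phased B)).1.
have pAB := (phased2_tens_r HC (gp_ob B) (gp_phased A)).1.
have [Z [m [n pZ]]] := phased2_ex HC (gp_base A ⊗ gp_base B) (munit ⊗ gp_ob B).
have [r [rm rn]] := pZ.1 _ (gp_in A ⊗₁ gp_in B) (gp_unit A ⊗₁ idm (gp_ob B)).
have mr : tens_monic r.
  apply: (phased2_half_monic HC pA pAB pZ); last exact: rn.
  by rewrite rm -tensm_comp comp_idl comp_idr.
have pS := gp_phased (A ⊗̂ B).
have [s [sm sn]] := pS.1 _ m (n ∘ ((idm munit ⊗₁ gp_unit B) ∘ bwd (ρ munit))).
have ms : tens_monic s.
  by apply: (phased2_half_monic HC pI (phased2_sym pZ) (phased2_sym pS)).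
have [||U [U1 U2 eU]] := pS.2 _ (r ∘ s) (c A B).
- by rewrite -comp_assoc sm rm gp_c_in.
- rewrite -comp_assoc sn gp_c_unit !comp_assoc rn -tensm_comp.
  by rewrite comp_idl comp_idr.
have [V [_ _ UV VU]] := phase_invertible pS U1 U2.
apply: (@tens_monic_heq _ _ _ (r ∘ s ∘ U)); first by rewrite eU.
apply: tens_monic_comp; first exact: tens_monic_comp.
by apply: tens_monic_invertible; exists V.
Qed.

Lemma gp_c_monic A B : monic (c A B).
Proof. exact/tens_monic_monic/gp_c_tens_monic. Qed.

Lemma gp_tensm_ex A A' B B' (f : GPHom A A') (g : GPHom B B') :
  exists h : GPHom (A ⊗̂ B) (A' ⊗̂ B'),
    c A' B' ∘ h ≡ (gp_hom f ⊗₁ gp_hom g) ∘ c A B /\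
    gp_basem h ≡ gp_basem f ⊗₁ gp_basem g.
Proof.
apply: gp_lift => //.
  by rewrite gp_c_in (comp_tail (gp_c_in _ _ _)) -!tensm_comp !gp_basemE.
by rewrite -comp_assoc !gp_c_point tens_point !gp_fix.
Qed.

Definition gp_tensm A A' B B' (f : GPHom A A') (g : GPHom B B') :
  GPHom (A ⊗̂ B) (A' ⊗̂ B') := sval (cid (gp_tensm_ex f g)).
Local Notation "f ⊠ g" := (gp_tensm f g) (at level 35, right associativity).

Lemma gp_tensmE A A' B B' (f : GPHom A A') (g : GPHom B B') :
  c A' B' ∘ (f ⊠ g) ≡ (gp_hom f ⊗₁ gp_hom g) ∘ c A B.
Proof. exact: (svalP (cid (gp_tensm_ex f g))).1. Qed.

Lemma gp_tensm_base A A' B B' (f : GPHom A A') (g : GPHom B B') :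
  gp_basem (f ⊠ g) ≡ gp_basem f ⊗₁ gp_basem g.
Proof. exact: (svalP (cid (gp_tensm_ex f g))).2. Qed.

Lemma gp_tensm_heq A A' B B' :
  Proper (@heq (GPCat C) A A' ==> @heq (GPCat C) B B' ==>
          @heq (GPCat C) (A ⊗̂ B) (A' ⊗̂ B')) (@gp_tensm A A' B B').
Proof.
rewrite /= /gp_eq => f f' ff' g g' gg' /=.
by apply: gp_c_monic; rewrite !gp_tensmE ff' gg'.
Qed.

Lemma gp_tensm_id A B : gp_eq (gp_id A ⊠ gp_id B) (gp_id (A ⊗̂ B)).
Proof.
by apply: gp_c_monic; rewrite gp_tensmE tensm_id comp_idl comp_idr.
Qed.

Lemma gp_tensm_comp A A' A'' B B' B'' (f' : GPHom A' A'') (f : GPHom A A')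
    (g' : GPHom B' B'') (g : GPHom B B') :
  gp_eq (gp_comp f' f ⊠ gp_comp g' g) (gp_comp (f' ⊠ g') (f ⊠ g)).
Proof.
apply: gp_c_monic; rewrite gp_tensmE /= comp_assoc gp_tensmE -comp_assoc.
by rewrite gp_tensmE comp_assoc -tensm_comp.
Qed.

Definition gp_cr A B E : Hom (gp_ob (A ⊗̂ (B ⊗̂ E))) (gp_ob A ⊗ gp_ob B ⊗ gp_ob E)
  := (idm (gp_ob A) ⊗₁ c B E) ∘ c A (B ⊗̂ E).

Definition gp_cl A B E :
    Hom (gp_ob ((A ⊗̂ B) ⊗̂ E)) ((gp_ob A ⊗ gp_ob B) ⊗ gp_ob E) :=
  (c A B ⊗₁ idm (gp_ob E)) ∘ c (A ⊗̂ B) E.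

Lemma gp_cr_tens_monic A B E : tens_monic (gp_cr A B E).
Proof.
apply: tens_monic_comp; last exact: gp_c_tens_monic.
exact/tens_monic_tens/gp_c_tens_monic.
Qed.

Lemma gp_cr_monic A B E : monic (gp_cr A B E).
Proof. exact/tens_monic_monic/gp_cr_tens_monic. Qed.

Lemma gp_cr_tensm A A' B B' E E' (f : GPHom A A') (g : GPHom B B')
    (h : GPHom E E') :
  gp_cr A' B' E' ∘ (f ⊠ (g ⊠ h)) ≡
  (gp_hom f ⊗₁ (gp_hom g ⊗₁ gp_hom h)) ∘ gp_cr A B E.
Proof.
rewrite /gp_cr -comp_assoc gp_tensmE !comp_assoc -!tensm_comp gp_tensmE.
by rewrite comp_idl comp_idr.
Qed.

Lemma gp_cl_tensm A A' B B' E E' (f : GPHom A A') (g : GPHom B B')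
    (h : GPHom E E') :
  gp_cl A' B' E' ∘ ((f ⊠ g) ⊠ h) ≡
  ((gp_hom f ⊗₁ gp_hom g) ⊗₁ gp_hom h) ∘ gp_cl A B E.
Proof.
rewrite /gp_cl -comp_assoc gp_tensmE !comp_assoc -!tensm_comp gp_tensmE.
by rewrite comp_idl comp_idr.
Qed.

Lemma gp_assoc_ex A B E :
  exists h : @Iso (GPCat C) ((A ⊗̂ B) ⊗̂ E) (A ⊗̂ (B ⊗̂ E)),
    gp_cr A B E ∘ gp_hom (fwd h) ≡
      α (gp_ob A) (gp_ob B) (gp_ob E) ∘ gp_cl A B E /\
    gp_basem (fwd h) ≡ α (gp_base A) (gp_base B) (gp_base E).
Proof.
have [||h [hE hb]] := @gp_lift _ HC ((A ⊗̂ B) ⊗̂ E) (A ⊗̂ (B ⊗̂ E)) _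
  (gp_cr A B E) (α (gp_ob A) (gp_ob B) (gp_ob E) ∘ gp_cl A B E)
  (α (gp_base A) (gp_base B) (gp_base E)).
- rewrite /gp_cr /gp_cl !comp_assoc !(comp_tail (gp_c_in _ _ _)) comp_tensm -tensm_comp.
  by rewrite !gp_c_in !comp_idl assoc_nat.
- rewrite /gp_cr /gp_cl -!comp_assoc !gp_c_point !tens_point !gp_c_point.
  by rewrite !comp_idl assoc_point.
have [|i ei] := @invertible_iso (GPCat C) _ _ h.
  apply: gp_invertible => //.
  by apply: (invertible_heq _ (iso_invertible (α _ _ _))); rewrite hb.
by exists i; rewrite ei.
Qed.

Definition gp_assoc A B E : @Iso (GPCat C) ((A ⊗̂ B) ⊗̂ E) (A ⊗̂ (B ⊗̂ E)) :=
  sval (cid (gp_assoc_ex A B E)).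
Local Notation assoc_hom A B E := (fwd (gp_assoc A B E)).

Lemma gp_assocE A B E :
  gp_cr A B E ∘ gp_hom (assoc_hom A B E) ≡
  α (gp_ob A) (gp_ob B) (gp_ob E) ∘ gp_cl A B E.
Proof. exact: (svalP (cid (gp_assoc_ex A B E))).1. Qed.

Lemma gp_assoc_base A B E :
  gp_basem (assoc_hom A B E) ≡ α (gp_base A) (gp_base B) (gp_base E).
Proof. exact: (svalP (cid (gp_assoc_ex A B E))).2. Qed.

Lemma gp_assoc_nat A A' B B' E E' (f : GPHom A A') (g : GPHom B B')
    (h : GPHom E E') :
  gp_eq (gp_comp (assoc_hom A' B' E') ((f ⊠ g) ⊠ h))
        (gp_comp (f ⊠ (g ⊠ h)) (assoc_hom A B E)).
Proof.
apply: gp_cr_monic => /=.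
rewrite !comp_assoc gp_assocE gp_cr_tensm (comp_tail (gp_cl_tensm _ _ _)).
by rewrite (comp_tail (gp_assocE _ _ _)) !comp_assoc assoc_nat.
Qed.

Lemma gp_pentagon A B E F :
  gp_eq
    (gp_comp (assoc_hom A B (E ⊗̂ F)) (assoc_hom (A ⊗̂ B) E F))
    (gp_comp (gp_comp (gp_id A ⊠ assoc_hom B E F) (assoc_hom A (B ⊗̂ E) F))
             (assoc_hom A B E ⊠ gp_id F)).
Proof.
(* [R] embeds the common target into the fourfold tensor product of underlying objects; there the
   claim reduces to [pentagon] in [C] and naturality. *)
pose R := (idm (gp_ob A) ⊗₁ gp_cr B E F) ∘ c A (B ⊗̂ E ⊗̂ F).
have mR : monic R.
  apply: monic_comp; last exact: gp_c_monic.
  exact: gp_cr_tens_monic.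
have R1 : R ≡ (idm _ ⊗₁ (idm _ ⊗₁ c E F)) ∘ gp_cr A B (E ⊗̂ F).
  by rewrite /R /gp_cr comp_assoc -tensm_comp comp_idl.
apply: mR => /=; rewrite !comp_assoc.
have -> : R ∘ (gp_id A ⊠ assoc_hom B E F) ≡
    (idm _ ⊗₁ fwd (α _ _ _)) ∘ (idm _ ⊗₁ (c B E ⊗₁ idm _)) ∘ gp_cr A (B ⊗̂ E) F.
  rewrite /R -comp_assoc gp_tensmE comp_assoc -tensm_comp gp_assocE.
  by rewrite /gp_cr !comp_assoc -!tensm_comp !comp_idl.
have an : (idm (gp_ob A) ⊗₁ (c B E ⊗₁ idm (gp_ob F))) ∘ α _ _ _ ≡
    α _ _ _ ∘ ((idm _ ⊗₁ c B E) ⊗₁ idm _) by rewrite assoc_nat.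
have am : (idm (gp_ob A) ⊗₁ (idm (gp_ob B) ⊗₁ c E F)) ∘ α _ _ _ ∘
    gp_cl A B (E ⊗̂ F) ≡
    α _ _ _ ∘ (c A B ⊗₁ idm _) ∘ gp_cr (A ⊗̂ B) E F.
  rewrite -assoc_nat /gp_cl /gp_cr !comp_assoc !comp_tensm tensm_id.
  by rewrite !comp_idl !comp_idr.
rewrite (comp_tail (gp_assocE _ _ _)) comp_assoc (comp_tail an) R1.
rewrite (comp_tail (gp_assocE _ _ _)) comp_assoc am (comp_tail (gp_assocE _ _ _)).
rewrite -(tensm_id (mstr C) (gp_ob E)) comp_assoc.
rewrite (comp_tail (symmetry (assoc_nat _ _ _ _))) comp_assoc pentagon.
rewrite /gp_cl !comp_assoc (comp_tail (gp_tensmE _ _)) !comp_assoc !comp_tensm.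
by rewrite !comp_assoc -/(gp_cr A B E) gp_assocE /gp_cl /= !comp_assoc !comp_idl.
Qed.

(** [c A B] is diagonal from [(A ⊗ B) ∔ I] to [(A ∔ I) ⊗ (B ∔ I)], split along its left factor.
    Transitivity moves [W] across it, strong preservation writes the result as [V ⊗₁ idm], and
    [c A B] is cancelled. *)
Lemma gp_phase_tens_r A B (W : GPHom (A ⊗̂ B) (A ⊗̂ B)) : gp_phase W ->
  exists V : GPHom A A, gp_phase V /\ gp_hom W ≡ V ⊠ gp_id B.
Proof.
move=> pW; have [pAB st] := phased2_tens_r HC (gp_ob B) (gp_phased A).
have [||T [T1 T2 eT]] := phased2_trans HC (f := c A B)
  (g := idm _ ⊗₁ gp_in B) (h := (idm _ ⊗₁ gp_unit B) ∘ bwd (ρ munit))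
  (gp_phased (A ⊗̂ B)) pAB _ _ (gp_phase_in pW) (gp_fix W).
- by rewrite gp_c_in -tensm_comp comp_idl comp_idr.
- by rewrite gp_c_unit comp_assoc -tensm_comp comp_idl comp_idr.
have [V [V1 V2 eV]] := st T T1 T2.
have [V' [VV' pV]] := gp_phase_mk HC V1 V2.
exists V'; split=> //; apply: gp_c_monic.
by rewrite eT gp_tensmE VV' eV.
Qed.

Lemma gp_phase_tens_l A B (W : GPHom (A ⊗̂ B) (A ⊗̂ B)) : gp_phase W ->
  exists V : GPHom B B, gp_phase V /\ gp_hom W ≡ gp_id A ⊠ V.
Proof.
move=> pW; have [pAB st] := phased2_tens_l HC (gp_ob A) (gp_phased B).
have [||T [T1 T2 eT]] := phased2_trans HC (f := c A B)
  (g := gp_in A ⊗₁ idm _) (h := (gp_unit A ⊗₁ idm _) ∘ bwd (ρ munit))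
  (gp_phased (A ⊗̂ B)) pAB _ _ (gp_phase_in pW) (gp_fix W).
- by rewrite gp_c_in -tensm_comp comp_idl comp_idr.
- by rewrite gp_c_unit comp_assoc -tensm_comp comp_idl comp_idr.
have [V [V1 V2 eV]] := st T T1 T2.
have [V' [VV' pV]] := gp_phase_mk HC V1 V2.
exists V'; split=> //; apply: gp_c_monic.
by rewrite eT gp_tensmE VV' eV.
Qed.

Lemma gp_fold_unit : exists d : Hom (gp_ob I) munit,
  d ∘ gp_in I ≡ idm munit /\ d ∘ gp_unit I ≡ idm munit.
Proof. exact: (gp_phased I).1. Qed.

(** Conjugation by [th] turns [h ⊠ gp_id I] into [h]. This [th] is a morphism of [C] built from any
    codiagonal [d], invertible as a comparison of two phased coproducts of [A ⊗ I] and [I]. It need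
    not be the unitor, which [β] prescribes. *)
Lemma gp_tensm_r_inj A B (f g : GPHom A B) :
  gp_eq (f ⊠ gp_id I) (g ⊠ gp_id I) -> gp_eq f g.
Proof.
rewrite /gp_eq; have [d [d1 d2]] := gp_fold_unit.
pose th E := ρ (gp_ob E) ∘ (idm _ ⊗₁ d) ∘ c E I.
have thi : invertible (th A).
  apply: (phased2_compare (gp_phased (A ⊗̂ I))); last 1 first.
  - rewrite -comp_assoc gp_c_unit !comp_assoc comp_tensm d2 comp_idl.
    by rewrite runit_nat (comp_tail (fwdK _)) comp_idr.
  - apply: phased2_heq; last exact: phased2_iso_in
      (iso_invertible (ρ (gp_base A))) (invertible_id munit) (gp_phased A).
    + by [].
    + by rewrite comp_idr.
  - by rewrite -comp_assoc gp_c_in comp_tensm d1 comp_idl runit_nat.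
have thN (h : GPHom A B) : h ∘ th A ≡ th B ∘ (h ⊠ gp_id I).
  rewrite /th (comp_tail (gp_tensmE _ _)) !comp_assoc comp_tensm comp_idl comp_idr.
  by rewrite -runit_nat comp_tensm comp_idl comp_idr.
by move=> e; apply: (invertible_epic thi); rewrite !thN e.
Qed.

Lemma gp_tensm_l_inj A B (f g : GPHom A B) :
  gp_eq (gp_id I ⊠ f) (gp_id I ⊠ g) -> gp_eq f g.
Proof.
rewrite /gp_eq; have [d [d1 d2]] := gp_fold_unit.
pose th E := λ (gp_ob E) ∘ (d ⊗₁ idm _) ∘ c I E.
have thi : invertible (th A).
  apply: (phased2_compare (gp_phased (I ⊗̂ A))); last 1 first.
  - rewrite -comp_assoc gp_c_unit !comp_assoc comp_tensm d2 comp_idl.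
    by rewrite lunit_nat lunit_runit (comp_tail (fwdK _)) comp_idr.
  - apply: phased2_heq; last exact: phased2_iso_in
      (iso_invertible (λ (gp_base A))) (invertible_id munit) (gp_phased A).
    + by [].
    + by rewrite comp_idr.
  - by rewrite -comp_assoc gp_c_in comp_tensm d1 comp_idl lunit_nat.
have thN (h : GPHom A B) : h ∘ th A ≡ th B ∘ (gp_id I ⊠ h).
  rewrite /th (comp_tail (gp_tensmE _ _)) !comp_assoc comp_tensm comp_idl comp_idr.
  by rewrite -lunit_nat comp_tensm comp_idl comp_idr.
by move=> e; apply: (invertible_epic thi); rewrite !thN e.
Qed.

Lemma gp_beta_base : gp_basem (fwd β) ≡ ρ munit.
Proof. by apply: gp_basem_uniq => //; rewrite gp_beta_in. Qed.

Lemma gp_iso_full A B (g : Iso (gp_base A) (gp_base B)) (V : GPHom B B) :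
  gp_phase V -> forall h : GPHom A B, gp_basem h ≡ g ->
  exists r : @Iso (GPCat C) A B, fwd r = gp_comp V h.
Proof.
move=> pV h hg; apply: (@invertible_iso (GPCat C)); apply: gp_invertible => //.
apply: (invertible_heq _ (iso_invertible g)).
by rewrite gp_basem_comp // pV comp_idl hg.
Qed.

(** A lift [r0] of [ρ] satisfies the equation on bases by [triangle], hence up to a phase [W] of
    [A ⊗̂ I]. As [W] has the form [V ⊠ gp_id I], correcting [r0] by [V] makes the equation exact. *)
Lemma gp_runit_ex A : exists r : @Iso (GPCat C) (A ⊗̂ I) A,
  gp_eq (fwd r ⊠ gp_id I) (gp_comp (gp_id A ⊠ fwd β) (assoc_hom A I I)).
Proof.
have [r0 r0E] := gp_full HC (A := A ⊗̂ I) (B := A) (ρ (gp_base A)).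
have [|W [pW eW]] := @gp_phase_diff_l _ HC _ _ (r0 ⊠ gp_id I)
  (gp_comp (gp_id A ⊠ fwd β) (assoc_hom A I I)).
  rewrite gp_basem_comp // !gp_tensm_base gp_assoc_base gp_beta_base r0E.
  by rewrite !gp_basem_id // -triangle lunit_runit.
have [V [pV eV]] := gp_phase_tens_r pW.
have [r rE] := gp_iso_full pV r0E.
exists r; rewrite rE /gp_eq eW eV.
have := gp_tensm_comp V r0 (gp_id I) (gp_id I); rewrite /gp_eq /= => <-.
by apply: gp_tensm_heq; rewrite /= /gp_eq /= ?comp_idl.
Qed.

Lemma gp_lunit_ex A : exists l : @Iso (GPCat C) (I ⊗̂ A) A,
  gp_eq (gp_id I ⊠ fwd l)
        (gp_comp (fwd β ⊠ gp_id A) (bwd (gp_assoc I I A))).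
Proof.
have [l0 l0E] := gp_full HC (A := I ⊗̂ A) (B := A) (λ (gp_base A)).
have ab : gp_basem (bwd (gp_assoc I I A)) ≡ bwd (α _ _ _).
  apply: (iso_monic (i := α _ _ _)); rewrite fwdK -gp_assoc_base.
  rewrite -(gp_basem_id HC); symmetry.
  rewrite -(gp_basem_heq HC (fwdK (gp_assoc I I A))).
  exact: (gp_basem_comp HC (fwd (gp_assoc I I A)) (bwd (gp_assoc I I A))).
have [|W [pW eW]] := @gp_phase_diff_l _ HC _ _ (gp_id I ⊠ l0)
  (gp_comp (fwd β ⊠ gp_id A) (bwd (gp_assoc I I A))).
  rewrite gp_basem_comp // !gp_tensm_base ab gp_beta_base l0E.
  by rewrite !gp_basem_id // -triangle -comp_assoc fwdK comp_idr.
have [V [pV eV]] := gp_phase_tens_l pW.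
have [l lE] := gp_iso_full pV l0E.
exists l; rewrite lE /gp_eq eW eV.
have := gp_tensm_comp (gp_id I) (gp_id I) V l0; rewrite /gp_eq /= => <-.
by apply: gp_tensm_heq; rewrite /= /gp_eq /= ?comp_idl.
Qed.

Definition gp_build : @Monoidal (GPCat C) (gp_tens ch) I :=
  @units_monoidal (GPCat C) (gp_tens ch) I gp_tensm gp_assoc
    gp_tensm_heq gp_tensm_id gp_tensm_comp gp_assoc_nat gp_pentagon β
    gp_tensm_r_inj gp_tensm_l_inj gp_runit_ex gp_lunit_ex.

Lemma gp_build_spec : is_gp_monoidal gp_build.
Proof.
split.
- move=> A A' B B' f g h; rewrite -gp_tensmE; split=> [/gp_c_monic//|e].
  by rewrite e.
- move=> A B E h; rewrite -/(gp_cr A B E).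
  rewrite -(comp_assoc (α _ _ _)) -/(gp_cl A B E) -gp_assocE.
  by split=> [/gp_cr_monic//|e]; rewrite e.
- move=> A r; have e :=
    @unit_rE (GPCat C) (gp_tens ch) I gp_tensm gp_assoc β gp_runit_ex A.
  split=> [er|er].
    by apply: gp_tensm_r_inj; exact: (heq_trans e (heq_sym er)).
  by refine (heq_trans _ e); apply: gp_tensm_heq; first exact: (heq_sym er).
- move=> A l; have e :=
    @unit_lE (GPCat C) (gp_tens ch) I gp_tensm gp_assoc β gp_lunit_ex A.
  split=> [el|el].
    by apply: gp_tensm_l_inj; exact: (heq_trans e (heq_sym el)).
  by refine (heq_trans _ e); apply: gp_tensm_heq; last exact: (heq_sym el).
Qed.

Lemma gp_exists : exists G : GP C, gp_choice G = ch.
Proof. by exists (Build_GP gp_build_spec). Qed.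

End GPTensor.

(** * Coproducts in GP *)

Section GPCoproducts.
Variable C : MonCat.
Hypothesis HC : phased_side C.

(** [(A ∔ I) ⊗ Z] splits into [A ⊗ I], [A ⊗ gp_base Z] and [I ⊗ Z]; the map [a] is the inclusion
    that misses the middle summand. *)
Lemma gp_pairing_monic (A Z : GPOb C) (Y : C) (i : Hom (gp_base A) Y)
    (j : Hom (gp_ob Z) Y) (a : Hom Y (gp_ob A ⊗ gp_ob Z)) :
  phased2 i j ->
  a ∘ i ≡ (gp_in A ⊗₁ gp_unit Z) ∘ bwd (ρ (gp_base A)) ->
  a ∘ j ≡ (gp_unit A ⊗₁ idm (gp_ob Z)) ∘ bwd (λ (gp_ob Z)) ->
  monic a.
Proof.
move=> pY ai aj; apply: tens_monic_monic.
have pX : phased2 ((idm (gp_base A) ⊗₁ gp_unit Z) ∘ bwd (ρ (gp_base A)))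
    ((idm (gp_base A) ⊗₁ gp_in Z) ∘ idm _).
  apply: phased2_iso_in; [exact: iso_inv_invertible | exact: invertible_id |].
  by apply: phased2_sym; exact: (phased2_tens_l HC _ (gp_phased Z)).1.
have pT : phased2 ((gp_in A ⊗₁ idm (gp_ob Z)) ∘ idm _)
    ((gp_unit A ⊗₁ idm (gp_ob Z)) ∘ bwd (λ (gp_ob Z))).
  apply: phased2_iso_in; [exact: invertible_id | exact: iso_inv_invertible |].
  exact: (phased2_tens_r HC _ (gp_phased A)).1.
apply: (phased2_half_monic HC pX pT pY) => //.
by rewrite ai comp_idr comp_assoc -tensm_split_l.
Qed.

Section Glue.
Variables (A B X : GPOb C) (p : GPHom A X) (q : GPHom B X).
Hypothesis pq : phased2 (gp_basem p) (gp_basem q).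

(** [X] is [(A ∔ B) ∔ I], rebracketed here as [A ∔ (B ∔ I)]. *)
Lemma gp_phased_r : phased2 (gp_in X ∘ gp_basem p) q.
Proof.
apply: phased2_sym.
apply: (phased2_assoc (phased2_ex HC _ _) (phased2_sym pq) (gp_phased X)
         (gp_phased B)); [exact: gp_basemE | exact: gp_fix].
Qed.

(** A weak pushout of [A ∔ I] and [B ∔ I] over [I]. A map that is right on [gp_base A] and on [q]
    differs from [f] by a phase of [A]; transitivity along [p] turns it into a phase of [X] that
    fixes [q]. *)
Lemma gp_glue (T : C) (f : Hom (gp_ob A) T) (g : Hom (gp_ob B) T) :
  f ∘ gp_unit A ≡ g ∘ gp_unit B ->
  exists h : Hom (gp_ob X) T, h ∘ p ≡ f /\ h ∘ q ≡ g.
Proof.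
move=> fg; have [h [hp hq]] := gp_phased_r.1 T (f ∘ gp_in A) g.
have [||U [U1 U2 eU]] := (gp_phased A).2 T (h ∘ p) f.
- by rewrite -comp_assoc gp_basemE.
- by rewrite -comp_assoc gp_fix -(gp_fix q) comp_assoc hq fg.
have [||W [W1 W2 eW]] := phased2_trans HC (f := p) (g := idm _)
  (h := gp_unit B) (gp_phased A) gp_phased_r _ _ U1 U2.
- by rewrite comp_idr gp_basemE.
- by rewrite !gp_fix.
exists (h ∘ W); split.
- by rewrite -comp_assoc -eW comp_assoc -eU.
- by rewrite -comp_assoc W2.
Qed.

Lemma gp_copair (E : GPOb C) (f : GPHom A E) (g : GPHom B E) :
  exists h : GPHom X E, h ∘ p ≡ f /\ h ∘ q ≡ g.
Proof.
have [|h [hp hq]] := @gp_glue _ f g; first by rewrite !gp_fix.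
have [k0 [k1 k2]] := pq.1 _ (gp_basem f) (gp_basem g).
(* The glued [h] is so far a morphism of [C]. On the base of [X] it agrees with [gp_in E ∘ k0] up to
   a phase, so [k0 ∘ U] is a base for it. *)
have [||U [_ _ eU]] := pq.2 _ (gp_in E ∘ k0) (h ∘ gp_in X).
- by rewrite -!comp_assoc k1 -(gp_basemE p) comp_assoc hp gp_basemE.
- by rewrite -!comp_assoc k2 -(gp_basemE q) comp_assoc hq gp_basemE.
have e2 : h ∘ gp_unit X ≡ gp_unit E.
  by rewrite -(gp_fix q) comp_assoc hq gp_fix.
by rewrite -comp_assoc in eU; exists (gp_mk eU e2).
Qed.

(** With [h' = h W] and [W p = p V], the phase [V] of [A ∔ I] satisfies
    [h p V = h p], so [W] is absorbed by [(h p ⊗ h q) a].  The latter factors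
    through [E ∔ (E ∔ I)] as [b D], and [h] factors through [D]. *)
Lemma gp_copair_uniq (E : GPOb C) (h h' : GPHom X E) :
  h ∘ p ≡ h' ∘ p -> h ∘ q ≡ h' ∘ q -> gp_hom h ≡ gp_hom h'.
Proof.
move=> ep eq.
have pY := gp_phased_r.
have [|W [W1 W2 eW]] := pY.2 _ h h' _ eq.
  by rewrite -gp_basemE !comp_assoc ep.
have [|a [ap aq]] := @gp_glue (gp_ob A ⊗ gp_ob B)
  ((idm _ ⊗₁ gp_unit B) ∘ bwd (ρ _)) ((gp_unit A ⊗₁ idm _) ∘ bwd (λ _)).
  by rewrite -point_tens_runit -point_tens_lunit.
have ai : a ∘ (gp_in X ∘ gp_basem p) ≡
    (gp_in A ⊗₁ gp_unit B) ∘ bwd (ρ (gp_base A)).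
  rewrite -gp_basemE comp_assoc ap -comp_assoc runit_natb comp_assoc.
  by rewrite -tensm_comp comp_idl comp_idr.
have ma : monic a by exact: gp_pairing_monic pY ai aq.
have [pT st] := phased2_tens_r HC (gp_ob B) (gp_phased A).
have [|T [T1 T2 eT]] := phased2_trans HC (f := a)
  (g := (idm _ ⊗₁ gp_unit B) ∘ bwd (ρ _)) (h := bwd (λ _)) pY pT _ aq W1 W2.
  by rewrite ai comp_assoc -tensm_split_l.
have [V [V1 V2 eV]] := st T T1 T2.
have Wp : W ∘ p ≡ p ∘ V.
  apply: ma; rewrite !comp_assoc eT eV ap -comp_assoc ap.
  rewrite -[in X in _ ≡ X](comp_assoc _ _ V) runit_natb comp_assoc.
  by rewrite comp_assoc -!tensm_comp !comp_idl !comp_idr.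
have [f ef] : exists f, f ≡ h ∘ p by exists (h ∘ p).
have [g eg] : exists g, g ≡ h ∘ q by exists (h ∘ q).
have fV : f ∘ V ≡ f by rewrite ef -comp_assoc -Wp comp_assoc -eW -ep.
have fgaW : (f ⊗₁ g) ∘ a ∘ W ≡ (f ⊗₁ g) ∘ a.
  by rewrite -comp_assoc eT eV comp_assoc -tensm_comp fV comp_idr.
have [Y [k1 [k2 pYE]]] := phased2_ex HC (gp_base E) (gp_ob E).
have [b [b1 b2]] := pYE.1 _ ((gp_in E ⊗₁ gp_unit E) ∘ bwd (ρ _))
  ((gp_unit E ⊗₁ idm _) ∘ bwd (λ _)).
have mb : monic b by exact: gp_pairing_monic pYE b1 b2.
have [D0 [D1 D2]] := pY.1 _ (k1 ∘ gp_basem h ∘ gp_basem p) (k2 ∘ g).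
have [||Z [Z1 Z2 eZ]] := pY.2 _ (b ∘ D0) ((f ⊗₁ g) ∘ a).
- rewrite -comp_assoc D1 -(comp_assoc _ a) ai !comp_assoc b1 -tensm_comp.
  rewrite ef eg -!(comp_assoc h) gp_basemE !gp_fix comp_assoc gp_basemE.
  rewrite -comp_assoc -[X in X ≡ _]comp_assoc runit_natb comp_assoc.
  by rewrite -tensm_comp comp_idr comp_assoc.
- rewrite -comp_assoc D2 -(comp_assoc _ a) aq !comp_assoc b2 -tensm_comp.
  rewrite ef -(comp_assoc h) !gp_fix -comp_assoc lunit_natb comp_assoc.
  by rewrite -tensm_comp comp_idl !comp_idr.
have [D eD] : exists D, D ≡ D0 ∘ Z by exists (D0 ∘ Z).
have DW : D ∘ W ≡ D by apply: mb; rewrite eD !comp_assoc -eZ fgaW.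
have Dp : D ∘ (gp_in X ∘ gp_basem p) ≡ k1 ∘ (gp_basem h ∘ gp_basem p).
  by rewrite eD -comp_assoc Z1 D1 comp_assoc.
have Dq : D ∘ q ≡ k2 ∘ g by rewrite eD -comp_assoc Z2.
have [d [d1 d2]] := pYE.1 _ (gp_in E) (idm _).
have [||R [R1 R2 eR]] := pY.2 _ (d ∘ D) h.
- by rewrite -comp_assoc Dp !comp_assoc d1 gp_basemE.
- by rewrite -comp_assoc Dq comp_assoc d2 comp_idl eg.
(* [D] is diagonal, so [D ∘ R ≡ S ∘ D]; then [h ∘ W ≡ d ∘ S ∘ D ∘ W], and [D] absorbs [W]. *)
have [S [_ _ eS]] := phased2_trans HC pY pYE Dp Dq R1 R2.
by rewrite eW eR -(comp_assoc d) eS -!comp_assoc DW.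
Qed.

Lemma gp_coproduct2 : @coproduct2 (GPCat C) _ _ _ p q.
Proof.
split=> [E f g|E h h' ep eq]; first exact: gp_copair.
exact: gp_copair_uniq.
Qed.

Lemma gp_coproj_monic : monic p.
Proof.
have pZ := phased2_half_monic HC pq (gp_phased X) (gp_phased A)
  (gp_basemE p) (gp_fix p).
exact: tens_monic_monic pZ.
Qed.

End Glue.

(** Any coproduct is isomorphic to the one built over a phased coproduct of the bases, and
    isomorphisms of [GP C] have invertible bases. *)
Lemma gp_coproduct2_phased (A B X : GPOb C) (p : GPHom A X) (q : GPHom B X) :
  @coproduct2 (GPCat C) _ _ _ p q -> phased2 (gp_basem p) (gp_basem q).
Proof.
move=> cop.
have [S [i [j pS]]] := phased2_ex HC (gp_base A) (gp_base B).
have [US] := unit_sum_exists HC S; pose Y := Build_GPOb US.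
have [p' ep'] := gp_full HC (A := A) (B := Y) i.
have [q' eq'] := gp_full HC (A := B) (B := Y) j.
have pY : phased2 (gp_basem p') (gp_basem q').
  by apply: phased2_heq pS; apply: heq_sym.
have [h1 h2] := gp_coproduct2 pY.
have [f [fp fq]] := h1 X p q; have [g [gp gq]] := cop.1 Y p' q'.
have fi : @invertible (GPCat C) Y X f.
  exists g; split.
    apply: h2; rewrite -comp_assoc.
      by rewrite fp gp comp_idl.
    by rewrite fq gq comp_idl.
  apply: cop.2; rewrite -comp_assoc.
    by rewrite gp fp comp_idl.
  by rewrite gq fq comp_idl.
apply: (@phased2_heq _ _ _ _ (gp_basem f ∘ gp_basem p') _
          (gp_basem f ∘ gp_basem q')).
- by rewrite -gp_basem_comp //; apply: gp_basem_heq.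
- by rewrite -gp_basem_comp //; apply: gp_basem_heq.
by apply: phased2_iso => //; apply: gp_invertible_base.
Qed.

Lemma gp_binary_coproduct (A B : GPCat C) :
  exists (X : GPCat C) (i : Hom A X) (j : Hom B X), coproduct2 i j.
Proof.
have [S [i [j pS]]] := phased2_ex HC (gp_base A) (gp_base B).
have [US] := unit_sum_exists HC S; pose Y := Build_GPOb US.
have [p' ep'] := gp_full HC (A := A) (B := Y) i.
have [q' eq'] := gp_full HC (A := B) (B := Y) j.
exists Y, p', q'; apply: gp_coproduct2.
by apply: phased2_heq pS; apply: heq_sym.
Qed.

(** The empty phased coproduct [O] has maps out of it unique only up to automorphisms. But
    [I -> O ∔ I] is invertible and every morphism of [GP C] is fixed on [I], so uniqueness is strict
    for [O ∔ I]. *)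
Lemma gp_initial : exists O : GPCat C, initial O.
Proof.
have [O [k [ex un]]] := phs_has HC (J := void) (of_void C).
have exO (T : C) : exists f : Hom O T, True.
  by have [f _] := ex T (fun i : void => match i with end); exists f.
have unO (T : C) (f g : Hom O T) : exists U : Hom O O,
    invertible U /\ g ≡ f ∘ U.
  have one X (h h' : Hom O X) : exists U : Hom O O, h' ≡ h ∘ U.
    by have [|U [_ eU]] := un X h h'; [case | exists U].
  have [U eU] := one _ f g; exists U; split=> //.
  have [V eV] := one _ U (idm O); have [W eW] := one _ V (idm O).
  have UW : U ≡ W by rewrite -(comp_idr U) eW comp_assoc -eV comp_idl.
  by exists V; split; [rewrite UW -eW | rewrite -eV].
have [US] := unit_sum_exists HC O; pose Z := Build_GPOb US.
have pZ := gp_phased Z.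
have ui : invertible (gp_unit Z).
  have [z _] := exO munit; have [n [n1 n2]] := pZ.1 _ z (idm munit).
  have [U [[U' [_ UU']] eU]] := unO _ (gp_in Z) (gp_unit Z ∘ z).
  have [e [e1 e2]] := pZ.1 _ (gp_in Z ∘ U') (gp_unit Z).
  (* [gp_unit Z ∘ n] fixes [gp_unit Z] but sends [gp_in Z] to [gp_in Z ∘ U]; [e] undoes [U]. The
     resulting phase is invertible and yields a right inverse of [gp_unit Z]. *)
  have [||V [_ _ eV _]] := phase_invertible (U := gp_unit Z ∘ n ∘ e) pZ.
  - rewrite -comp_assoc e1 comp_assoc -(comp_assoc _ n) n1 eU.
    by rewrite -comp_assoc UU' comp_idr.
  - by rewrite -comp_assoc e2 -comp_assoc n2 comp_idr.
  by apply: (invertible_lr (g := n) (h := n ∘ e ∘ V)); rewrite // !comp_assoc.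
exists Z => T; split.
  have [f0 _] := exO (gp_base T); have [f _] := gp_full HC (A := Z) (B := T) f0.
  by exists f.
move=> f g; apply: (invertible_epic (f := gp_unit Z) ui).
by rewrite !gp_fix.
Qed.

Lemma gp_finite_coproducts : has_finite_coproducts (GPCat C).
Proof.
exact: finite_coproducts_of_binary gp_initial gp_binary_coproduct.
Qed.

Lemma gp_monic_finite_coproducts : monic_finite_coproducts (GPCat C).
Proof.
apply: monic_finite_coproducts_of_binary gp_initial gp_binary_coproduct _.
move=> A B X i j /gp_coproduct2_phased pX T f g e.
exact: (gp_coproj_monic pX e).
Qed.

End GPCoproducts.

(** * Global phases of GP *)

Section ScalarActions.
Variable D : MonCat.
Implicit Types s : Hom (@munit D) munit.

Lemma lscal_compl s (A B : D) (f : Hom A B) :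
  lscal s f ≡ lscal s (idm B) ∘ f.
Proof. by rewrite -[in X in _ ≡ X](lscal_id f) lscal_comp comp_idl comp_idr. Qed.

Lemma lscal_compr s (A B : D) (f : Hom A B) :
  lscal s f ≡ f ∘ lscal s (idm A).
Proof. by rewrite -[in X in _ ≡ X](lscal_id f) lscal_comp comp_idl comp_idr. Qed.

Lemma rscal_compl s (A B : D) (f : Hom A B) :
  rscal f s ≡ rscal (idm B) s ∘ f.
Proof.
rewrite /rscal -(comp_assoc _ (bwd _)) runit_natb comp_assoc.
by rewrite comp_tensm comp_idl comp_idr.
Qed.

Lemma rscal_compr s (A B : D) (f : Hom A B) :
  rscal f s ≡ f ∘ rscal (idm A) s.
Proof. by rewrite /rscal !comp_assoc -runit_nat comp_tensm comp_idl comp_idr. Qed.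

Lemma lscal_unit s : lscal s (idm munit) ≡ s.
Proof.
rewrite /lscal lunit_runitb lunit_runit runit_nat -comp_assoc fwdK.
by rewrite comp_idr.
Qed.

Lemma rscal_unit s : rscal (idm munit) s ≡ s.
Proof.
rewrite /rscal -lunit_runitb -lunit_runit lunit_nat -comp_assoc fwdK.
by rewrite comp_idr.
Qed.

End ScalarActions.

Section GPSide.
Variable C : MonCat.
Hypothesis HC : phased_side C.
Variable G : GP C.
Local Notation ch := (gp_choice G).
Local Notation M := (gp_monoidal G).
Implicit Types A B E : GPOb C.

Lemma gp_tensE A A' B B' (f : GPHom A A') (g : GPHom B B') :
  gp_c ch A' B' ∘ gp_hom (tensm M f g) ≡
  (gp_hom f ⊗₁ gp_hom g) ∘ gp_c ch A B.
Proof. exact/(gpm_tensm (gp_spec G)). Qed.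

Lemma gp_tens_base A A' B B' (f : GPHom A A') (g : GPHom B B') :
  gp_basem (tensm M f g) ≡ gp_basem f ⊗₁ gp_basem g.
Proof.
apply: (gp_basem_uniq HC); apply: (gp_c_monic HC).
rewrite !comp_assoc gp_tensE gp_c_in (comp_tail (gp_c_in _ _ _)) -!tensm_comp.
by rewrite !gp_basemE.
Qed.

(** Transfers results on the constructed tensor, such as [gp_phase_tens_l], to an arbitrary [G]. *)
Lemma gp_tens_gp_tensm A A' B B' (f : GPHom A A') (g : GPHom B B') :
  gp_hom (tensm M f g) ≡ gp_hom (gp_tensm HC ch f g).
Proof. by apply: (gp_c_monic HC); rewrite gp_tensE gp_tensmE. Qed.

Lemma gp_ascE A B E :
  gp_cr ch A B E ∘ gp_hom (fwd (assoc M A B E)) ≡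
  α (gp_ob A) (gp_ob B) (gp_ob E) ∘ gp_cl ch A B E.
Proof.
rewrite /gp_cl comp_assoc; exact/(gpm_assoc (gp_spec G)).
Qed.

Lemma gp_asc_base A B E :
  gp_basem (fwd (assoc M A B E)) ≡ α (gp_base A) (gp_base B) (gp_base E).
Proof.
apply: (gp_basem_uniq HC); apply: (gp_cr_monic HC).
rewrite !comp_assoc gp_ascE /gp_cr /gp_cl !comp_assoc !(comp_tail (gp_c_in _ _ _)).
by rewrite comp_tensm -tensm_comp !gp_c_in !comp_idl assoc_nat.
Qed.

Lemma gp_iso_base_inv A B (i : @Iso (GPCat C) A B)
    (j : Iso (gp_base A) (gp_base B)) :
  gp_basem (fwd i) ≡ j -> gp_basem (bwd i) ≡ bwd j.
Proof.
move=> e; apply: (iso_monic (i := j)); rewrite fwdK -e -(gp_basem_id HC).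
rewrite -(gp_basem_heq HC (fwdK i)); apply: heq_sym.
exact: (gp_basem_comp HC (fwd i) (bwd i)).
Qed.

Lemma gp_runit_base A : gp_basem (fwd (runit M A)) ≡ ρ (gp_base A).
Proof.
have /(gp_basem_heq HC) :=
  (gpm_runit (gp_spec G) (fwd (runit M A))).2 (heq_refl _).
rewrite gp_basem_comp // !gp_tens_base gp_asc_base gp_beta_base //.
rewrite !gp_basem_id // -lunit_runit triangle; exact: tensm_Ir_inj.
Qed.

Lemma gp_lunit_base A : gp_basem (fwd (lunit M A)) ≡ λ (gp_base A).
Proof.
have /(gp_basem_heq HC) :=
  (gpm_lunit (gp_spec G) (fwd (lunit M A))).2 (heq_refl _).
rewrite gp_basem_comp // !gp_tens_base (gp_iso_base_inv (gp_asc_base _ _ _)).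
rewrite gp_beta_base // !gp_basem_id // -triangle -comp_assoc fwdK comp_idr.
exact: tensm_Il_inj.
Qed.

Lemma gp_distributive : distributive_coproducts G.
Proof.
move=> A; split=> B X k /coproduct2P cop; apply/coproduct2P.
- apply: (gp_coproduct2 HC (A := gp_tens ch A (B true))
    (B := gp_tens ch A (B false)) (X := gp_tens ch A X)).
  apply: phased2_heq (phased2_tens_l HC (gp_base A)
    (gp_coproduct2_phased HC cop)).1.
  + by rewrite gp_tens_base gp_basem_id.
  + by rewrite gp_tens_base gp_basem_id.
- apply: (gp_coproduct2 HC (A := gp_tens ch (B true) A)
    (B := gp_tens ch (B false) A) (X := gp_tens ch X A)).
  apply: phased2_heq (phased2_tens_r HC (gp_base A)
    (gp_coproduct2_phased HC cop)).1.
  + by rewrite gp_tens_base gp_basem_id.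
  + by rewrite gp_tens_base gp_basem_id.
Qed.

Lemma gp_coproduct_side : coproduct_side G.
Proof.
split.
- exact: gp_finite_coproducts.
- exact: gp_monic_finite_coproducts.
- exact: gp_distributive.
Qed.

Lemma gp_phasesP (u : Hom (@munit G) munit) : gp_phases u <-> gp_phase u.
Proof.
split=> [pu|pu].
  by apply: (gp_basem_uniq HC); rewrite comp_idr; exact: (pu true).
by case; [exact: gp_phase_in | exact: gp_fix].
Qed.

(** Conjugating [W] by the right unitor gives a phase of the tensor product of [A] with the unit,
    which is [idm A ⊗₁ u] by [gp_phase_tens_l]. *)
Lemma gp_phase_rscal (A : G) (W : Hom A A) : gp_phase W ->
  exists u : Hom (@munit G) munit, gp_phase u /\ W ≡ rscal (idm A) u.
Proof.
move=> pW; have pW' : gp_phase (bwd (ρ A) ∘ W ∘ ρ A).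
  rewrite /gp_phase !gp_basem_comp // (gp_iso_base_inv (gp_runit_base A)).
  by rewrite gp_runit_base pW comp_idr bwdK.
have [u [pu eu]] := gp_phase_tens_l HC pW'.
exists u; split=> //; rewrite /rscal.
have eu' : bwd (ρ A) ∘ W ∘ ρ A ≡ idm A ⊗₁ u.
  exact: heq_trans eu (heq_sym (gp_tens_gp_tensm (gp_id A) u)).
by rewrite -eu' !comp_assoc fwdK comp_idl -comp_assoc fwdK comp_idr.
Qed.

Lemma gp_lscal_phase (A : G) (u : Hom (@munit G) munit) :
  gp_phase u -> gp_phase (lscal u (idm A)).
Proof.
move=> pu; rewrite /gp_phase /lscal !gp_basem_comp //.
rewrite (gp_iso_base_inv (gp_lunit_base A)) gp_lunit_base gp_tens_base pu.
by rewrite gp_basem_id // tensm_id comp_idr fwdK.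
Qed.

(** The left action of [u] on [A ⊔ I] is a phase, hence the right action of some
    [u']; restricting to [I] gives [u = u'], restricting to [A] the claim. *)
Lemma gp_phase_central (u : Hom (@munit G) munit) : gp_phase u -> central u.
Proof.
move=> pu A B f.
have [X [i [j cop]]] := gp_binary_coproduct HC A (@munit G).
have pX := gp_coproduct2_phased HC cop.
have mi : @monic G _ _ i by move=> Z g h; apply: (gp_coproj_monic HC pX).
have mj : @monic G _ _ j.
  by move=> Z g h; apply: (gp_coproj_monic HC (phased2_sym pX)).
have [u' [_ eu']] := gp_phase_rscal (gp_lscal_phase X pu).
have uu' : u ≡ u'.
  apply: mj; rewrite -[in X in X ≡ _](lscal_unit u).
  rewrite -[in X in _ ≡ X](rscal_unit u').
  by rewrite -lscal_compr -rscal_compr lscal_compl rscal_compl eu'.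
rewrite lscal_compr rscal_compr; apply: comp_heq => //.
apply: mi; rewrite -lscal_compr -rscal_compr lscal_compl rscal_compl eu'.
by rewrite /rscal uu'.
Qed.

Lemma gp_global_phases : is_global_phases (gp_phases (G := G)).
Proof.
split.
- by move=> s t e; rewrite !gp_phasesP /gp_phase => <-;
    apply: gp_basem_heq => //; exact: heq_sym.
- move=> s /gp_phasesP ps.
  have [|t [ts st]] := gp_invertible HC (f := s); last by exists t.
  by apply: (invertible_heq _ (invertible_id _)); rewrite ps.
- by move=> s /gp_phasesP; exact: gp_phase_central.
- by apply/gp_phasesP; exact: gp_basem_id.
- by move=> s t /gp_phasesP ps /gp_phasesP pt; apply/gp_phasesP;
    rewrite /gp_phase gp_basem_comp // ps pt comp_idl.
- move=> s t /gp_phasesP ps st _; apply/gp_phasesP.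
  have := gp_basem_heq HC st; rewrite [X in X ≡ _]gp_basem_comp // ps comp_idl.
  by move=> e; rewrite /gp_phase e; exact: gp_basem_id.
Qed.

Definition gp_forget : Functor G C :=
  @Build_Functor G C (fun A => gp_base A) (fun A B f => gp_basem f)
    (fun A B f g => @gp_basem_heq _ HC A B f g)
    (gp_basem_id HC) (fun A B E g f => gp_basem_comp HC g f).

End GPSide.

(** * Quotients by global phases *)

Definition id_iso (C : Category) (A : C) : Iso A A :=
  Build_Iso (comp_idl (idm A)) (comp_idl (idm A)).

Fact iso_comp_bwdK (C : Category) (A B E : C) (j : Iso B E) (i : Iso A B) :
  (bwd i ∘ bwd j) ∘ (j ∘ i) ≡ idm A.
Proof. by rewrite !comp_assoc (comp_tail (bwdK j)) comp_idr bwdK. Qed.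

Fact iso_comp_fwdK (C : Category) (A B E : C) (j : Iso B E) (i : Iso A B) :
  (j ∘ i) ∘ (bwd i ∘ bwd j) ≡ idm E.
Proof. by rewrite !comp_assoc (comp_tail (fwdK i)) comp_idr fwdK. Qed.

Definition iso_comp (C : Category) (A B E : C) (j : Iso B E) (i : Iso A B) :
  Iso A E := Build_Iso (iso_comp_bwdK j i) (iso_comp_fwdK j i).

Fact fmap_bwdK (C D : Category) (F : Functor C D) (A B : C) (i : Iso A B) :
  fmap F (bwd i) ∘ fmap F i ≡ idm (F A).
Proof. by rewrite -fmap_comp bwdK fmap_id. Qed.

Fact fmap_fwdK (C D : Category) (F : Functor C D) (A B : C) (i : Iso A B) :
  fmap F i ∘ fmap F (bwd i) ≡ idm (F B).
Proof. by rewrite -fmap_comp fwdK fmap_id. Qed.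

Definition fmap_iso (C D : Category) (F : Functor C D) (A B : C)
    (i : Iso A B) : Iso (F A) (F B) :=
  Build_Iso (fmap_bwdK F i) (fmap_fwdK F i).

(** * Composites of functors and of monoidal functors *)

Section FunctorComposite.
Variables (C D E : Category) (H : Functor D E) (F : Functor C D).

Fact fcomp_heq (A B : C) :
  Proper (@heq C A B ==> heq) (fun f : Hom A B => fmap H (fmap F f)).
Proof. by move=> f g e; rewrite e. Qed.

Fact fcomp_id (A : C) : fmap H (fmap F (idm A)) ≡ idm (H (F A)).
Proof. by rewrite !fmap_id. Qed.

Fact fcomp_comp (A B X : C) (g : Hom B X) (f : Hom A B) :
  fmap H (fmap F (g ∘ f)) ≡ fmap H (fmap F g) ∘ fmap H (fmap F f).
Proof. by rewrite !fmap_comp. Qed.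

Definition fcomp : Functor C E := Build_Functor fcomp_heq fcomp_id fcomp_comp.

End FunctorComposite.

Section MonFunctorComposite.
Variables (C D E : MonCat) (H : MonFunctor D E) (F : MonFunctor C D).

Let T (A B : C) : Iso (H (F A) ⊗ H (F B)) (H (F (A ⊗ B))) :=
  iso_comp (fmap_iso H (mfun_tens F A B)) (mfun_tens H (F A) (F B)).
Let U : Iso munit (H (F munit)) :=
  iso_comp (fmap_iso H (mfun_unit F)) (mfun_unit H).

Fact mcomp_nat (A A' B B' : C) (f : Hom A A') (g : Hom B B') :
  T A' B' ∘ (fmap (fcomp H F) f ⊗₁ fmap (fcomp H F) g) ≡
  fmap (fcomp H F) (f ⊗₁ g) ∘ T A B.
Proof. by rewrite /= -comp_assoc mfun_nat !comp_assoc -!fmap_comp mfun_nat. Qed.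

Fact mcomp_assoc (A B X : C) :
  fmap (fcomp H F) (α A B X) ∘ T (A ⊗ B) X ∘ (T A B ⊗₁ idm (fcomp H F X)) ≡
  T A (B ⊗ X) ∘ (idm (fcomp H F A) ⊗₁ T B X)
    ∘ α (fcomp H F A) (fcomp H F B) (fcomp H F X).
Proof.
have e1 : T A B ⊗₁ idm (H (F X)) ≡
    (fmap H (mfun_tens F A B) ⊗₁ fmap H (idm _)) ∘ (mfun_tens H _ _ ⊗₁ idm _).
  by rewrite -tensm_comp fmap_id comp_idl.
have e2 : idm (H (F A)) ⊗₁ T B X ≡
    (fmap H (idm _) ⊗₁ fmap H (mfun_tens F B X)) ∘ (idm _ ⊗₁ mfun_tens H _ _).
  by rewrite -tensm_comp fmap_id comp_idl.
rewrite e1 e2 /= !comp_assoc !(comp_tail (mfun_nat _ _ _)) !comp_assoc.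
rewrite -!fmap_comp mfun_assoc fmap_comp -!comp_assoc.
by apply: comp_heq => //; rewrite !comp_assoc mfun_assoc.
Qed.

Fact mcomp_lunit (A : C) :
  fmap (fcomp H F) (λ A) ∘ T munit A ∘ (U ⊗₁ idm (fcomp H F A)) ≡
  λ (fcomp H F A).
Proof.
have e : U ⊗₁ idm (H (F A)) ≡
    (fmap H (mfun_unit F) ⊗₁ fmap H (idm _)) ∘ (mfun_unit H ⊗₁ idm _).
  by rewrite -tensm_comp fmap_id comp_idl.
rewrite e /= !comp_assoc (comp_tail (mfun_nat _ _ _)) !comp_assoc -!fmap_comp.
by rewrite !mfun_lunit.
Qed.

Fact mcomp_runit (A : C) :
  fmap (fcomp H F) (ρ A) ∘ T A munit ∘ (idm (fcomp H F A) ⊗₁ U) ≡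
  ρ (fcomp H F A).
Proof.
have e : idm (H (F A)) ⊗₁ U ≡
    (fmap H (idm _) ⊗₁ fmap H (mfun_unit F)) ∘ (idm _ ⊗₁ mfun_unit H).
  by rewrite -tensm_comp fmap_id comp_idl.
rewrite e /= !comp_assoc (comp_tail (mfun_nat _ _ _)) !comp_assoc -!fmap_comp.
by rewrite !mfun_runit.
Qed.

Definition mcomp : MonFunctor C E :=
  Build_MonFunctor mcomp_nat mcomp_assoc mcomp_lunit mcomp_runit.

End MonFunctorComposite.

(** Conjugation by [mfun_unit] is the transport of scalars in [gph_equiv]; hence an equivalence
    matching the phases also matches the congruences [qeq]. *)
Lemma fmap_lscal (C D : MonCat) (F : MonFunctor C D)
    (s : Hom (@munit C) munit) (A B : C) (g : Hom A B) :
  fmap F (lscal s g) ≡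
  lscal (bwd (mfun_unit F) ∘ fmap F s ∘ mfun_unit F) (fmap F g).
Proof.
set s' := _ ∘ mfun_unit F.
have sE : mfun_unit F ∘ s' ≡ fmap F s ∘ mfun_unit F.
  by rewrite /s' !comp_assoc fwdK comp_idl.
apply: (iso_epic (i := λ (F A))); rewrite /lscal (comp_tail (bwdK _)) comp_idr.
rewrite -!mfun_lunit !comp_assoc -fmap_comp (comp_tail (bwdK _)) comp_idr.
rewrite comp_tensm sE comp_idl -[X in _ ≡ _ ∘ (_ ⊗₁ X)]comp_idr tensm_comp.
by rewrite comp_assoc (comp_tail (mfun_nat _ _ _)) fmap_comp !comp_assoc.
Qed.

(** * Functors that present their target as a quotient *)

Record exhibits_quotient (D C : MonCat) (P : Hom (@munit D) munit -> Prop)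
    (K : MonFunctor D C) : Prop := {
  exq_full : full K;
  exq_surj : essentially_surjective K;
  exq_ker : forall (A B : D) (f g : Hom A B),
    fmap K f ≡ fmap K g <-> qeq P f g }.

Section ExhibitsQuotient.
Variables (D C : MonCat) (P : Hom (@munit D) munit -> Prop).
Variable HP : is_global_phases P.
Variable K : MonFunctor D C.
Hypothesis HK : exhibits_quotient P K.

Fact quotient_functor_heq (A B : quotient HP) :
  Proper (@heq (quotient HP) A B ==> heq) (@fmap D C K A B).
Proof. by move=> f g e; apply/(exq_ker HK). Qed.

Definition quotient_functor : Functor (quotient HP) C :=
  @Build_Functor (quotient HP) C (fun A => K A) (fun A B f => fmap K f)
    quotient_functor_heq (fmap_id K) (fun A B E g f => fmap_comp K g f).

Definition quotient_mon_functor : MonFunctor (quotient HP) C :=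
  @Build_MonFunctor (quotient HP) C quotient_functor
    (mfun_tens K) (mfun_unit K)
    (fun A A' B B' f g => mfun_nat K f g) (mfun_assoc K) (mfun_lunit K)
    (mfun_runit K).

Lemma exhibits_quotient_mon_equiv : mon_equiv (quotient HP) C.
Proof.
exists quotient_mon_functor; apply: equivalence_intro.
- exact: exq_full HK.
- by move=> A B f f' e; apply/(exq_ker HK).
- exact: exq_surj HK.
Qed.

(** If lifts of [h] and [h'] agree after [K] on leg [i], they differ there by a scalar [u i] of [P].
    The phase relating them is the image of the endomorphism [U] that multiplies each leg by its
    [u i]. *)
Lemma exhibits_quotient_phased (J : Type) (A : J -> D) (X : D)
    (k : forall i, Hom (A i) X) :
  is_coproduct k -> is_phased_coproduct (fun i => fmap K (k i)).
Proof.
move=> cop; split=> [B f|B h h' e].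
  have [B' [j]] := exq_surj HK B.
  pose f' i := sval (cid (exq_full HK (bwd j ∘ f i))).
  have f'E i : fmap K (f' i) ≡ bwd j ∘ f i.
    exact: svalP (cid (exq_full HK (bwd j ∘ f i))).
  have [[h eh] _] := cop B' f'; exists (j ∘ fmap K h) => i.
  by rewrite -comp_assoc -fmap_comp eh f'E comp_assoc fwdK comp_idl.
have [B' [j]] := exq_surj HK B.
have [h1 e1] := exq_full HK (bwd j ∘ h).
have [h2 e2] := exq_full HK (bwd j ∘ h').
have u i : {u | P u /\ h2 ∘ k i ≡ lscal u (h1 ∘ k i)}.
  by apply: cid; apply/(exq_ker HK); rewrite !fmap_comp e1 e2 -!comp_assoc e.
have [[U eU] _] := cop X (fun i => lscal (sval (u i)) (k i)).
have uP i := svalP (u i).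
exists (fmap K U); split.
  move=> i; rewrite -fmap_comp; apply/(exq_ker HK).
  by exists (sval (u i)); split; [exact: (uP i).1 | exact: eU].
have [_ un] := cop B' (fun i => h2 ∘ k i).
have e21 : h2 ≡ h1 ∘ U.
  apply: un => i; rewrite (uP i).2 -comp_assoc eU.
  by rewrite lscal_compr [in X in _ ≡ X]lscal_compr comp_assoc.
apply: (invertible_monic (iso_inv_invertible j)).
by rewrite comp_assoc -e1 -e2 e21 fmap_comp.
Qed.

End ExhibitsQuotient.

Section QuotientProjection.
Variables (D : MonCat) (P : Hom (@munit D) munit -> Prop).
Variable HP : is_global_phases P.

Definition quotient_proj_functor : Functor D (quotient HP) :=
  @Build_Functor D (quotient HP) (fun A => A) (fun A B f => f)
    (fun A B f g e => heq_qeq HP e) (fun A => heq_qeq HP (heq_refl _))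
    (fun A B E g f => heq_qeq HP (heq_refl _)).

Definition quotient_proj : MonFunctor D (quotient HP).
Proof.
refine (@Build_MonFunctor D (quotient HP) quotient_proj_functor
  (fun A B => @id_iso (quotient HP) (A ⊗ B)) (@id_iso (quotient HP) munit)
  _ _ _ _).
- by move=> A A' B B' f g; apply: (heq_qeq HP); rewrite /= comp_idl comp_idr.
- move=> A B E; apply: (heq_qeq HP).
  by rewrite /= !tensm_id !comp_idl !comp_idr.
- by move=> A; apply: (heq_qeq HP); rewrite /= tensm_id !comp_idr.
- by move=> A; apply: (heq_qeq HP); rewrite /= tensm_id !comp_idr.
Defined.

Lemma quotient_proj_exhibits : exhibits_quotient P quotient_proj.
Proof.
split=> //.
- by move=> A B g; exists g; apply: (heq_qeq HP).
- by move=> X; exists X; split; exact: id_iso.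
Qed.

End QuotientProjection.

Lemma exhibits_quotient_compl (D C C' : MonCat) P (K : MonFunctor D C)
    (H : MonFunctor C C') :
  exhibits_quotient P K -> is_equivalence H ->
  exhibits_quotient P (mcomp H K).
Proof.
move=> HK eH; split.
- move=> A B g; have [g' eg] := equivalence_full eH g.
  by have [f ef] := exq_full HK g'; exists f; rewrite /= ef.
- move=> X; have [Y [j]] := equivalence_essentially_surjective eH X.
  have [A [i]] := exq_surj HK Y.
  by exists A; split; exact: iso_comp j (fmap_iso H i).
- move=> A B f g; rewrite -(exq_ker HK) /=; split=> [|e].
    exact: equivalence_faithful.
  by rewrite e.
Qed.

Lemma exhibits_quotient_compr (D D' C : MonCat)
    (P : Hom (@munit D) munit -> Prop) (P' : Hom (@munit D') munit -> Prop)
    (F : MonFunctor D D') (K : MonFunctor D' C) :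
  is_global_phases P' -> is_equivalence F ->
  (forall s, P s <-> P' (bwd (mfun_unit F) ∘ fmap F s ∘ mfun_unit F)) ->
  exhibits_quotient P' K -> exhibits_quotient P (mcomp K F).
Proof.
move=> HP' eF FP HK; split.
- move=> A B g; have [g' eg] := exq_full HK g.
  by have [f ef] := equivalence_full eF g'; exists f; rewrite /= ef.
- move=> X; have [Y [j]] := exq_surj HK X.
  have [A [i]] := equivalence_essentially_surjective eF Y.
  by exists A; split; exact: iso_comp j (fmap_iso K i).
- move=> A B f g; rewrite /= (exq_ker HK); split=> [[v [Pv e]]|[s [Ps e]]].
    have [s es] := equivalence_full eF (mfun_unit F ∘ v ∘ bwd (mfun_unit F)).
    have sv : bwd (mfun_unit F) ∘ fmap F s ∘ mfun_unit F ≡ v.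
      by rewrite es !comp_assoc bwdK comp_idl -comp_assoc bwdK comp_idr.
    exists s; split; first by apply/FP; apply: (gph_heq HP' (heq_sym sv)).
    by apply: (equivalence_faithful eF); rewrite e fmap_lscal sv.
  exists (bwd (mfun_unit F) ∘ fmap F s ∘ mfun_unit F).
  by split; [apply/FP | rewrite e fmap_lscal].
Qed.

(** * Phased coproducts in the quotient by global phases *)

Section QuotientPhased.
Variables (D : MonCat) (P : Hom (@munit D) munit -> Prop).
Variable HP : is_global_phases P.
Hypothesis HD : coproduct_side D.

Lemma comp_lscal_l s (A B E : D) (g : Hom B E) (f : Hom A B) :
  lscal s g ∘ f ≡ lscal s (g ∘ f).
Proof. by rewrite -{1}(lscal_id f) lscal_comp comp_idr. Qed.

Lemma comp_lscal_r s (A B E : D) (g : Hom B E) (f : Hom A B) :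
  g ∘ lscal s f ≡ lscal s (g ∘ f).
Proof. by rewrite -{1}(lscal_id g) lscal_comp comp_idl. Qed.

Lemma lscal_tensr u (A A' B B' : D) (f : Hom A A') (g : Hom B B') : P u ->
  f ⊗₁ lscal u g ≡ lscal u (f ⊗₁ g).
Proof. by move=> Pu; rewrite !(gph_central HP Pu) rscal_tensr. Qed.

Lemma scalar_comm s t : P s -> s ∘ t ≡ t ∘ s.
Proof.
move=> Ps; have := gph_central HP Ps t.
by rewrite lscal_compl lscal_unit rscal_compr rscal_unit.
Qed.

Lemma lscal_cancel u : P u ->
  exists t, [/\ P t, forall (A B : D) (f : Hom A B), lscal u (lscal t f) ≡ f
    & forall (A B : D) (f : Hom A B), lscal t (lscal u f) ≡ f].
Proof.
move=> Pu; have [t [ut tu]] := gph_inv HP Pu; exists t.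
split; first exact: gph_closed_inv Pu ut tu.
  by move=> A B f; rewrite lscal_lscal ut lscal_id.
by move=> A B f; rewrite lscal_lscal tu lscal_id.
Qed.

(** For the forward direction a phased coproduct [X] is compared with a coproduct [X'] of [D]
    through [f]. A map [g] back matches the legs up to scalars: rescaling each leg gives a left
    inverse of [f], while [f ∘ g] agrees with the identity on legs in the quotient, which gives a
    right inverse. *)
Lemma quotient_coproductP (J : finType) (A : J -> D) (X : D)
    (k : forall i, Hom (A i) X) :
  @is_phased_coproduct (quotient HP) J A X k <-> is_coproduct k.
Proof.
split; last exact: exhibits_quotient_phased (quotient_proj_exhibits HP) _ _ _ k.
move=> [ex un]; have [X' [k' cop']] := cps_has HD A.
have [[f ef] _] := cop' X k; have [g eg] := ex X' k'.
have [h hf] : exists h, h ∘ f ≡ idm X'.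
  have u i := cid (eg i).
  have t i := cid (lscal_cancel (svalP (u i)).1).
  have [[e ee] _] := cop' X' (fun i => lscal (sval (t i)) (k' i)).
  exists (e ∘ g); have [_ un'] := cop' X' k'; apply: un' => i.
  rewrite -!comp_assoc ef (svalP (u i)).2 comp_lscal_r ee comp_idl.
  by have [_ -> _] := svalP (t i).
have [h' fh'] : exists h', f ∘ h' ≡ idm X.
  have [|U [_ [u [Pu eU]]]] := un X (f ∘ g : @Hom (quotient HP) X X) (idm X).
    move=> i; have [u [Pu eu]] := eg i; exists u; split=> //.
    by rewrite /= -comp_assoc eu comp_idl comp_lscal_r ef.
  by exists (g ∘ lscal u U); rewrite comp_assoc comp_lscal_r -eU.
have [f' [f'f ff']] := invertible_lr hf fh'.
move=> B x; split.
  have [[y ey] _] := cop' B x; exists (y ∘ f') => i.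
  by rewrite -ef !comp_assoc (comp_tail f'f) comp_idr.
move=> y y' e; have [_ un'] := cop' B (fun i => y ∘ f ∘ k' i).
rewrite -(comp_idr y) -(comp_idr y') -ff' !comp_assoc.
by rewrite (un' (y ∘ f) (y' ∘ f)) // => i; rewrite -!comp_assoc ef.
Qed.

Lemma quotient_has_phased : has_finite_phased_coproducts (quotient HP).
Proof.
move=> J A; have [X [k cop]] := cps_has HD A.
by exists X, k; apply/quotient_coproductP.
Qed.

Lemma quotient_monic : monic_finite_phased_coproducts (quotient HP).
Proof.
move=> J A X k /quotient_coproductP cop i Y f g [u [Pu e]].
exists u; split=> //; apply: (@cps_monic _ HD J A X k cop i).
by rewrite comp_lscal_r.
Qed.

(** On leg [i] a phase of the tensor product multiplies by a scalar [u i]. Multiplying leg [i] of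
    [X] by the same scalar induces it, since scalars pass out of a tensor product, out of its right
    factor by centrality. *)
Lemma quotient_distributive : distributive_phased_coproducts (quotient HP).
Proof.
move=> A; split=> B X k /quotient_coproductP cop.
- have copA := (cps_distr HD A).1 B X k cop.
  split; first by apply/quotient_coproductP.
  move=> W pW; have u i := cid (pW i).
  have [[U eU] _] := cop X (fun i => lscal (sval (u i)) (k i)).
  exists U; split.
    by move=> i; exists (sval (u i)); split; [exact: (svalP (u i)).1 | exact: eU].
  suff e : (W : @Hom D (A ⊗ X) (A ⊗ X)) ≡ idm (A : D) ⊗₁ U by exact: heq_qeq.
  have [_ un] := copA (A ⊗ X) (fun i => lscal (sval (u i)) (idm A ⊗₁ k i)).
  apply: un => i; rewrite (svalP (u i)).2 /= -tensm_comp eU comp_idl.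
  by rewrite lscal_tensr //; exact: (svalP (u i)).1.
- have copA := (cps_distr HD A).2 B X k cop.
  split; first by apply/quotient_coproductP.
  move=> W pW; have u i := cid (pW i).
  have [[U eU] _] := cop X (fun i => lscal (sval (u i)) (k i)).
  exists U; split.
    by move=> i; exists (sval (u i)); split; [exact: (svalP (u i)).1 | exact: eU].
  suff e : (W : @Hom D (X ⊗ A) (X ⊗ A)) ≡ U ⊗₁ idm (A : D) by exact: heq_qeq.
  have [_ un] := copA (X ⊗ A) (fun i => lscal (sval (u i)) (k i ⊗₁ idm A)).
  apply: un => i; rewrite (svalP (u i)).2 /= -tensm_comp eU comp_idl.
  by rewrite lscal_tensl.
Qed.

(** [V] multiplies each leg of [Y] by the scalar through which [U] acts on the corresponding leg of
    [X]. The morphism [f] matches legs up to a further scalar [v], which commutes with it. *)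
Lemma quotient_transitive : transitive_phases (quotient HP).
Proof.
move=> A B X Y k l /quotient_coproductP copX /quotient_coproductP copY f U df pU.
have u i := cid (pU i).
have [[V eV] _] := copY Y (fun i => lscal (sval (u i)) (l i)).
exists V; split.
  by move=> i; exists (sval (u i)); split; [exact: (svalP (u i)).1 | exact: eV].
pose f' : @Hom D X Y := f; pose U' : @Hom D X X := U.
suff e : f' ∘ U' ≡ V ∘ f' by exact: heq_qeq.
have [_ un] := copX Y (fun i => f' ∘ U' ∘ k i).
apply: un => i; have [g [v [Pv eg]]] := df i; have Pu' := (svalP (u i)).1.
rewrite -!comp_assoc (svalP (u i)).2 comp_lscal_r eg comp_lscal_r comp_assoc.
by rewrite eV comp_lscal_l !lscal_lscal (scalar_comm v Pu').
Qed.

Lemma quotient_phased_side : phased_side (quotient HP).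
Proof.
split.
- exact: quotient_has_phased.
- exact: quotient_monic.
- exact: quotient_distributive.
- exact: quotient_transitive.
Qed.

End QuotientPhased.

Section ForgetMonoidal.
Variable C : MonCat.
Hypothesis HC : phased_side C.
Variable G : GP C.

Definition gp_forget_mon : MonFunctor G C.
Proof.
refine (@Build_MonFunctor G C (gp_forget HC G)
  (fun A B => id_iso _) (id_iso _) _ _ _ _).
- move=> A A' B B' f g; rewrite /= comp_idl comp_idr.
  by apply: heq_sym; apply: gp_tens_base.
- move=> A B E; rewrite /= !tensm_id !comp_idl !comp_idr.
  exact: gp_asc_base.
- by move=> A; rewrite /= tensm_id !comp_idr; exact: gp_lunit_base.
- by move=> A; rewrite /= tensm_id !comp_idr; exact: gp_runit_base.
Defined.

Lemma gp_forget_exhibits : exhibits_quotient (gp_phases (G := G)) gp_forget_mon.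
Proof.
split.
- exact: gp_full HC.
- move=> X; have [US] := unit_sum_exists HC X.
  by exists (Build_GPOb US); split; exact: id_iso.
- move=> A B f g; split=> [e|[u [/(gp_phasesP HC) pu e]]].
    have [W [pW eW]] := gp_phase_diff_l HC (heq_sym e).
    have [u [pu eu]] := gp_phase_rscal HC pW.
    exists u; split; first exact/(gp_phasesP HC).
    rewrite (gp_phase_central HC pu) rscal_compl -eu; exact: eW.
  rewrite lscal_compl in e; rewrite /= (gp_basem_heq HC e) gp_basem_comp //.
  by rewrite (gp_lscal_phase HC B pu) comp_idl.
Qed.

End ForgetMonoidal.

(** * Reconstruction of a category from its quotient *)

(** Since the unitors of [GP(C)] are only characterised through [β], the unit
    laws of a functor into [GP(C)] are checked in terms of a map [b : I ⊗ I -> I]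
    instead of the unitors of the target. *)
Section UnitConstraint.
Variables (D E : MonCat) (F : Functor D E).
Variable t : forall A B : D, Iso (F A ⊗ F B) (F (A ⊗ B)).
Hypothesis t_nat : forall (A A' B B' : D) (f : Hom A A') (g : Hom B B'),
  t A' B' ∘ (fmap F f ⊗₁ fmap F g) ≡ fmap F (f ⊗₁ g) ∘ t A B.
Hypothesis t_assoc : forall A B X : D,
  fmap F (α A B X) ∘ t (A ⊗ B) X ∘ (t A B ⊗₁ idm (F X)) ≡
  t A (B ⊗ X) ∘ (idm (F A) ⊗₁ t B X) ∘ α (F A) (F B) (F X).
Variables (e : Hom munit (F munit)) (b : Hom (munit ⊗ munit) (@munit E)).
Hypothesis eb : e ∘ b ≡ fmap F (ρ munit) ∘ t munit munit ∘ (e ⊗₁ e).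
Hypothesis ei : invertible e.

(** The equation by which [gpm_lunit] characterises the left unitor, with [b] for [β]. Composing
    with [e ⊗₁ idm] and [t] lands both sides in [F (munit ⊗ A)], where [t_assoc] and [triangle]
    apply. *)
Lemma unit_constraint_l (A : D) :
  idm munit ⊗₁ (fmap F (λ A) ∘ t munit A ∘ (e ⊗₁ idm (F A))) ≡
  (b ⊗₁ idm (F A)) ∘ bwd (α munit munit (F A)).
Proof.
apply/(iso_move_r (α munit munit (F A))).
apply: (invertible_monic (tensm_invertible ei (invertible_id (F A)))).
apply: (iso_monic (i := t munit A)).
transitivity (fmap F (ρ munit ⊗₁ idm A) ∘ t _ _ ∘ (t _ _ ⊗₁ idm _)
    ∘ ((e ⊗₁ e) ⊗₁ idm _)); last first.
  by rewrite -t_nat fmap_id !comp_tensm -tensm_comp eb !comp_idl !comp_assoc.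
rewrite -triangle fmap_comp -(comp_assoc _ (fmap F (α _ _ _))).
rewrite -(comp_assoc _ (fmap F (α _ _ _) ∘ _)) t_assoc.
rewrite -(comp_assoc _ (_ ∘ α _ _ _)) -(comp_assoc _ (α _ _ _)) assoc_nat.
rewrite !comp_assoc -t_nat fmap_id !comp_tensm !comp_idl.
by rewrite comp_idr -!comp_assoc.
Qed.

Lemma unit_constraint_r (A : D) :
  (fmap F (ρ A) ∘ t A munit ∘ (idm (F A) ⊗₁ e)) ⊗₁ idm munit ≡
  (idm (F A) ⊗₁ b) ∘ α (F A) munit munit.
Proof.
apply: (invertible_monic (tensm_invertible (invertible_id (F A)) ei)).
apply: (iso_monic (i := t A munit)).
transitivity (fmap F (ρ A ⊗₁ idm _) ∘ t _ _ ∘ (t _ _ ⊗₁ idm _)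
    ∘ ((idm _ ⊗₁ e) ⊗₁ e)).
  rewrite -t_nat fmap_id !comp_tensm -tensm_comp !comp_idl !comp_idr.
  by rewrite !comp_assoc.
rewrite -triangle lunit_runit fmap_comp -(comp_assoc _ (fmap F (α _ _ _))).
rewrite -(comp_assoc _ (fmap F (α _ _ _) ∘ _)) t_assoc.
rewrite -(comp_assoc _ (_ ∘ α _ _ _)) -(comp_assoc _ (α _ _ _)) assoc_nat.
rewrite !comp_assoc -t_nat fmap_id !comp_tensm !comp_idl.
by rewrite eb !comp_assoc.
Qed.

End UnitConstraint.

Section MonFunctorInverse.
Variables (D C : MonCat) (K : MonFunctor D C).
Local Notation K2 := (mfun_tens K).
Local Notation K0 := (mfun_unit K).

Lemma mfun_natb (A A' B B' : D) (f : Hom A A') (g : Hom B B') :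
  bwd (K2 A' B') ∘ fmap K (f ⊗₁ g) ≡ (fmap K f ⊗₁ fmap K g) ∘ bwd (K2 A B).
Proof.
apply: (iso_epic (i := K2 A B)).
by rewrite -comp_assoc -mfun_nat comp_assoc bwdK comp_idl -comp_assoc bwdK comp_idr.
Qed.

Lemma mfun_assocb (A B X : D) :
  (idm (K A) ⊗₁ bwd (K2 B X)) ∘ bwd (K2 A (B ⊗ X)) ∘ fmap K (α A B X) ≡
  α (K A) (K B) (K X) ∘ (bwd (K2 A B) ⊗₁ idm (K X)) ∘ bwd (K2 (A ⊗ B) X).
Proof.
apply: (iso_epic (i := K2 (A ⊗ B) X)).
apply: (tensm_iso_epic (i := K2 A B)).
rewrite (comp_tail (bwdK (K2 (A ⊗ B) X))) comp_idr comp_tensm bwdK comp_idl tensm_id.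
rewrite comp_idr -!(comp_assoc (_ ∘ bwd _)) mfun_assoc.
rewrite !comp_assoc (comp_tail (bwdK _)) comp_idr -tensm_comp bwdK comp_idl.
by rewrite tensm_id comp_idl.
Qed.

Lemma mfun_unit_runit :
  K0 ∘ ρ munit ≡ fmap K (ρ munit) ∘ K2 munit munit ∘ (K0 ⊗₁ K0).
Proof.
rewrite -runit_nat -mfun_runit -!comp_assoc -tensm_comp.
by rewrite comp_idl comp_idr.
Qed.

Lemma mfun_point (A B : D) (x : Hom munit A) (y : Hom munit B) :
  bwd (K2 A B) ∘ fmap K (point_tens x y) ∘ K0 ≡
  point_tens (fmap K x ∘ K0) (fmap K y ∘ K0).
Proof.
have e' : bwd (K2 munit munit) ∘ fmap K (bwd (ρ munit)) ∘ K0 ≡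
    (K0 ⊗₁ K0) ∘ bwd (ρ munit).
  apply: (iso_epic (i := ρ munit)); rewrite -comp_assoc.
  rewrite mfun_unit_runit !comp_assoc.
  rewrite -(comp_assoc _ (fmap K _) (fmap K _)) -fmap_comp bwdK fmap_id comp_idr.
  by rewrite bwdK comp_idl -comp_assoc bwdK comp_idr.
rewrite /point_tens fmap_comp comp_assoc mfun_natb tensm_comp.
by rewrite -!comp_assoc -e' !comp_assoc.
Qed.

End MonFunctorInverse.

Record CoprodWithUnit (D : MonCat) (A : D) := {
  cu_ob : D;
  cu_in : Hom A cu_ob;
  cu_unit : Hom munit cu_ob;
  cu_coproduct : coproduct2 cu_in cu_unit }.

Section Reconstruction.
Variables (D C : MonCat) (P : Hom (@munit D) munit -> Prop).
Hypothesis HP : is_global_phases P.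
Hypothesis HD : coproduct_side D.
Hypothesis HC : phased_side C.
Variable K : MonFunctor D C.
Hypothesis HK : exhibits_quotient P K.
Variable G : GP C.
Local Notation K2 := (mfun_tens K).
Local Notation K0 := (mfun_unit K).
Local Notation c := (gp_c (gp_choice G)).

Lemma coproduct2_monic (A B X : D) (i : Hom A X) (j : Hom B X) :
  coproduct2 i j -> monic i /\ monic j.
Proof.
move=> cop; have m := @cps_monic _ HD bool (pair A B) X (copair i j).
by split; [apply: (m _ true) | apply: (m _ false)]; apply/coproduct2P.
Qed.

Fact coprod_with_unit_ex (A : D) : exists S : CoprodWithUnit A, True.
Proof.
have [X [i [j cop]]] := binary_coproduct A munit (cps_has HD).
by exists (Build_CoprodWithUnit cop).
Qed.

Definition cu (A : D) : CoprodWithUnit A := sval (cid (coprod_with_unit_ex A)).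
Local Notation S A := (cu_ob (cu A)).
Local Notation κ A := (cu_in (cu A)).
Local Notation ι A := (cu_unit (cu A)).

Lemma cu_ext (A X : D) (f g : Hom (S A) X) :
  f ∘ κ A ≡ g ∘ κ A -> f ∘ ι A ≡ g ∘ ι A -> f ≡ g.
Proof. exact: (cu_coproduct (cu A)).2. Qed.

Lemma cu_in_monic (A : D) : monic (κ A).
Proof. exact: (coproduct2_monic (cu_coproduct (cu A))).1. Qed.

Lemma cu_unit_monic (A : D) : monic (ι A).
Proof. exact: (coproduct2_monic (cu_coproduct (cu A))).2. Qed.

Definition cu_map (A B : D) (f : Hom A B) : Hom (S A) (S B) :=
  sval (cid ((cu_coproduct (cu A)).1 _ (κ B ∘ f) (ι B))).

Lemma cu_map_in (A B : D) (f : Hom A B) : cu_map f ∘ κ A ≡ κ B ∘ f.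
Proof. exact: (svalP (cid ((cu_coproduct (cu A)).1 _ (κ B ∘ f) (ι B)))).1. Qed.

Lemma cu_map_unit (A B : D) (f : Hom A B) : cu_map f ∘ ι A ≡ ι B.
Proof. exact: (svalP (cid ((cu_coproduct (cu A)).1 _ (κ B ∘ f) (ι B)))).2. Qed.

(** The counterpart of [gp_c] for true coproducts: its naturality and associativity hold on
    coprojections, and [K] carries them to [C]. *)
Definition cu_diag (A B : D) : Hom (S (A ⊗ B)) (S A ⊗ S B) :=
  sval (cid ((cu_coproduct (cu (A ⊗ B))).1 _
    (κ A ⊗₁ κ B) (point_tens (ι A) (ι B)))).
Local Notation δ := cu_diag.

Lemma cu_diag_in (A B : D) : δ A B ∘ κ (A ⊗ B) ≡ κ A ⊗₁ κ B.
Proof. exact: (svalP (cid ((cu_coproduct (cu (A ⊗ B))).1 _ _ _))).1. Qed.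

Lemma cu_diag_unit (A B : D) : δ A B ∘ ι (A ⊗ B) ≡ point_tens (ι A) (ι B).
Proof. exact: (svalP (cid ((cu_coproduct (cu (A ⊗ B))).1 _ _ _))).2. Qed.

Lemma cu_diag_nat (A A' B B' : D) (f : Hom A A') (g : Hom B B') :
  (cu_map f ⊗₁ cu_map g) ∘ δ A B ≡ δ A' B' ∘ cu_map (f ⊗₁ g).
Proof.
apply: cu_ext; rewrite -!comp_assoc.
  by rewrite cu_map_in cu_diag_in comp_assoc cu_diag_in -!tensm_comp !cu_map_in.
by rewrite cu_map_unit !cu_diag_unit tens_point !cu_map_unit.
Qed.

Lemma cu_diag_assoc (A B X : D) :
  (idm (S A) ⊗₁ δ B X) ∘ δ A (B ⊗ X) ∘ cu_map (α A B X) ≡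
  α (S A) (S B) (S X) ∘ (δ A B ⊗₁ idm (S X)) ∘ δ (A ⊗ B) X.
Proof.
apply: cu_ext.
  rewrite (comp_tail (cu_map_in _)) comp_assoc !(comp_tail (cu_diag_in _ _)).
  by rewrite comp_tensm -tensm_comp !cu_diag_in !comp_idl assoc_nat.
rewrite (comp_tail (cu_map_unit _)) !(comp_tail (cu_diag_unit _ _)) -comp_assoc.
by rewrite !tens_point !cu_diag_unit !comp_idl assoc_point.
Qed.

Fact rec_phased (A : D) : phased2 (fmap K (κ A)) (fmap K (ι A) ∘ K0).
Proof.
have /(exhibits_quotient_phased HK) ph :=
  proj2 (coproduct2P (copair (κ A) (ι A))) (cu_coproduct (cu A)).
apply: (phased2_heq (comp_idr _) (heq_refl _)).
apply: phased2_iso_in; first exact: invertible_id.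
  exact: iso_invertible.
exact: (proj1 (phased2P _) ph).
Qed.

Definition rec_ob (A : D) : GPOb C :=
  Build_GPOb (Build_UnitSum (phased2_copair (rec_phased A))).

Fact rec_map_in (A B : D) (f : Hom A B) :
  fmap K (cu_map f) ∘ gp_in (rec_ob A) ≡ gp_in (rec_ob B) ∘ fmap K f.
Proof. by rewrite /gp_in /= -!fmap_comp cu_map_in. Qed.

Fact rec_map_unit (A B : D) (f : Hom A B) :
  fmap K (cu_map f) ∘ gp_unit (rec_ob A) ≡ gp_unit (rec_ob B).
Proof. by rewrite /gp_unit /= comp_assoc -!fmap_comp cu_map_unit. Qed.

Definition rec_map (A B : D) (f : Hom A B) : GPHom (rec_ob A) (rec_ob B) :=
  @gp_mk C (rec_ob A) (rec_ob B) _ _ (rec_map_in f) (rec_map_unit f).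

Lemma rec_map_base (A B : D) (f : Hom A B) : gp_basem (rec_map f) ≡ fmap K f.
Proof. exact/(gp_basem_uniq HC)/rec_map_in. Qed.

Lemma cu_map_heq (A B : D) : Proper (heq ==> heq) (@cu_map A B).
Proof.
by move=> f g e; apply: cu_ext; rewrite ?cu_map_in ?cu_map_unit ?e.
Qed.
#[local] Existing Instance cu_map_heq.

Fact rec_heq (A B : D) : Proper (@heq D A B ==> @heq G _ _) (@rec_map A B).
Proof. by move=> f g e; rewrite /= /gp_eq /= e. Qed.

Fact rec_id (A : D) : gp_eq (rec_map (idm A)) (gp_id (rec_ob A)).
Proof.
rewrite /gp_eq /= -[X in _ ≡ X](fmap_id K); apply: fmap_heq.
by apply: cu_ext; rewrite ?cu_map_in ?cu_map_unit ?comp_idl ?comp_idr.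
Qed.

Fact rec_comp (A B X : D) (g : Hom B X) (f : Hom A B) :
  gp_eq (rec_map (g ∘ f)) (gp_comp (rec_map g) (rec_map f)).
Proof.
rewrite /gp_eq /= -fmap_comp; apply: fmap_heq; apply: cu_ext.
  by rewrite -comp_assoc !cu_map_in !comp_assoc cu_map_in.
by rewrite -comp_assoc !cu_map_unit.
Qed.

Definition rec_functor : Functor D G :=
  @Build_Functor D G rec_ob rec_map rec_heq rec_id rec_comp.

(** If [K] identifies the two extensions, they differ by one scalar [u]. Both fix the unit summand,
    whose coprojection is monic, so [u] acts as the identity. *)
Lemma rec_faithful : faithful rec_functor.
Proof.
move=> A B f g /(exq_ker HK) [u [_ e]].
have u1 : lscal u (idm munit) ≡ idm (@munit D).
  apply: (cu_unit_monic (A := B)).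
  by rewrite comp_lscal_r // -(cu_map_unit g) comp_idr -comp_lscal_l // -e
    !cu_map_unit.
apply: (cu_in_monic (A := B)).
by rewrite -!cu_map_in e -{1}(lscal_unit u) u1 lscal_id.
Qed.

(** A lift [h0] along [K] fixes the unit summand up to a scalar [u] and has base [g] up to a scalar
    [v]. Dividing by [u] makes it fix that summand exactly, so it is the extension of a multiple of
    [g]. *)
Lemma rec_full : full rec_functor.
Proof.
move=> A B h; have [h0 e0] := exq_full HK (gp_hom h).
have [u [Pu eu]] : qeq P (h0 ∘ ι A) (ι B).
  apply/(exq_ker HK); apply: (iso_epic (i := K0)).
  by rewrite fmap_comp e0; have := gp_fix h; rewrite /gp_unit /= comp_assoc.
have [t [Pt ut tu]] := lscal_cancel HP Pu.
have [g eg] := exq_full HK (gp_basem h).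
have [v [_ ev]] : qeq P (h0 ∘ κ A) (κ B ∘ g).
  by apply/(exq_ker HK); rewrite !fmap_comp e0 eg;
    exact: (@gp_basemE C (rec_ob A) (rec_ob B) h).
exists (lscal t (lscal v g)); rewrite /= /gp_eq /= -e0.
apply/(exq_ker HK); exists t; split=> //; apply: cu_ext.
  by rewrite cu_map_in comp_lscal_l ev -!comp_lscal_r.
by rewrite cu_map_unit comp_lscal_l eu tu.
Qed.

Lemma rec_surj : essentially_surjective rec_functor.
Proof.
move=> X; have [A [j]] := exq_surj HK (gp_base X).
have [h hj] := gp_full HC (A := rec_ob A) (B := X) j.
have [|i _] := @invertible_iso (GPCat C) _ _ h; last by exists A; split.
apply: (gp_invertible HC); apply: (invertible_heq _ (iso_invertible j)).
exact: heq_sym.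
Qed.

(** The inverse of [t] is the one described: [gp_c] is monic, so it determines morphisms into the
    tensor product of [GP C]. *)
Fact rec_tens_ex (A B : D) :
  exists t : @Iso G (rec_functor A ⊗ rec_functor B) (rec_functor (A ⊗ B)),
    c (rec_ob A) (rec_ob B) ∘ gp_hom (bwd t) ≡
      bwd (K2 (S A) (S B)) ∘ fmap K (δ A B) /\
    gp_basem (bwd t) ≡ bwd (K2 A B).
Proof.
have [||s [es bs]] := @gp_lift _ HC (rec_ob (A ⊗ B))
  (gp_tens (gp_choice G) (rec_ob A) (rec_ob B)) _
  (c (rec_ob A) (rec_ob B)) (bwd (K2 (S A) (S B)) ∘ fmap K (δ A B))
  (bwd (K2 A B)).
- by rewrite gp_c_in -comp_assoc -fmap_comp cu_diag_in mfun_natb.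
- rewrite gp_c_point /gp_unit /= comp_assoc -(comp_assoc (bwd _)) -fmap_comp.
  by rewrite cu_diag_unit mfun_point.
have [|i ei] := @invertible_iso (GPCat C) _ _ s.
  apply: (gp_invertible HC).
  apply: (invertible_heq _ (iso_inv_invertible (K2 A B))); exact: heq_sym.
by exists (Build_Iso (fwdK i) (bwdK i)); rewrite /= ei.
Qed.

Definition rec_tens (A B : D) :
    @Iso G (rec_functor A ⊗ rec_functor B) (rec_functor (A ⊗ B)) :=
  sval (cid (rec_tens_ex A B)).
Local Notation t := rec_tens.

Lemma rec_tensE (A B : D) :
  c (rec_ob A) (rec_ob B) ∘ gp_hom (bwd (t A B)) ≡
  bwd (K2 (S A) (S B)) ∘ fmap K (δ A B).
Proof. exact: (svalP (cid (rec_tens_ex A B))).1. Qed.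

Lemma rec_tensb_base (A B : D) : gp_basem (bwd (t A B)) ≡ bwd (K2 A B).
Proof. exact: (svalP (cid (rec_tens_ex A B))).2. Qed.

Lemma rec_tens_base (A B : D) : gp_basem (fwd (t A B)) ≡ K2 A B.
Proof.
have e := rec_tensb_base A B.
have /(gp_basem_heq HC) := bwdK (t A B).
rewrite (gp_basem_comp HC (bwd (t A B)) (fwd (t A B))) e gp_basem_id // => e'.
by apply: (iso_monic (i := Build_Iso (fwdK (K2 A B)) (bwdK (K2 A B))));
   rewrite /= e' bwdK.
Qed.

Fact rec_tens_nat (A A' B B' : D) (f : Hom A A') (g : Hom B B') :
  t A' B' ∘ (fmap rec_functor f ⊗₁ fmap rec_functor g) ≡
  fmap rec_functor (f ⊗₁ g) ∘ t A B.
Proof.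
apply/(iso_move_l (t A' B')); rewrite comp_assoc.
apply: heq_sym; apply/(iso_move_r (t A B)); apply: heq_sym.
rewrite /= /gp_eq /=; apply: (gp_c_monic HC).
rewrite !comp_assoc gp_tensE (comp_tail (rec_tensE _ _)) rec_tensE.
by rewrite comp_assoc -mfun_natb -!(comp_assoc (bwd _)) -!fmap_comp cu_diag_nat.
Qed.

Fact rec_tens_assoc (A B X : D) :
  fmap rec_functor (α A B X) ∘ t (A ⊗ B) X ∘ (t A B ⊗₁ idm (rec_functor X)) ≡
  t A (B ⊗ X) ∘ (idm (rec_functor A) ⊗₁ t B X)
    ∘ α (rec_functor A) (rec_functor B) (rec_functor X).
Proof.
(* Only [bwd t] has a formula through [gp_c], so the inverted form of the coherence law is proved
   first. *)
have e : (idm (rec_functor A) ⊗₁ bwd (t B X)) ∘ bwd (t A (B ⊗ X))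
    ∘ fmap rec_functor (α A B X) ≡
    α (rec_functor A) (rec_functor B) (rec_functor X)
    ∘ (bwd (t A B) ⊗₁ idm (rec_functor X)) ∘ bwd (t (A ⊗ B) X).
  rewrite /= /gp_eq /=; apply: (gp_cr_monic HC).
  rewrite !comp_assoc gp_ascE /gp_cr /gp_cl.
  have L : (idm (K (S A)) ⊗₁ (bwd (K2 (S B) (S X)) ∘ fmap K (δ B X)))
      ∘ bwd (K2 (S A) (S (B ⊗ X))) ≡
      (idm _ ⊗₁ bwd (K2 _ _)) ∘ bwd (K2 _ _) ∘ fmap K (idm (S A) ⊗₁ δ B X).
    by rewrite -comp_assoc mfun_natb fmap_id comp_assoc -tensm_comp comp_idl.
  have R : ((bwd (K2 (S A) (S B)) ∘ fmap K (δ A B)) ⊗₁ idm (K (S X)))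
      ∘ bwd (K2 (S (A ⊗ B)) (S X)) ≡
      (bwd (K2 _ _) ⊗₁ idm _) ∘ bwd (K2 _ _) ∘ fmap K (δ A B ⊗₁ idm (S X)).
    by rewrite -comp_assoc mfun_natb fmap_id comp_assoc -tensm_comp comp_idl.
  rewrite !(comp_tail (gp_tensE _ _ _)) !comp_assoc !(comp_tail (gp_tensE _ _ _)).
  rewrite !comp_assoc !(comp_tail (rec_tensE _ _)) !comp_assoc !comp_tensm -!tensm_comp.
  rewrite !rec_tensE /= !comp_idl L (comp_tail R) !comp_assoc.
  rewrite !(comp_tail (heq_sym (fmap_comp _ _ _))) !comp_assoc cu_diag_assoc.
  by rewrite !fmap_comp !comp_assoc mfun_assocb.
have t1 : (bwd (t A B) ⊗₁ idm (rec_functor X)) ∘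
    (t A B ⊗₁ idm (rec_functor X)) ≡ idm _.
  by rewrite -tensm_comp bwdK comp_idl tensm_id.
have t2 : (idm (rec_functor A) ⊗₁ t B X) ∘
    (idm (rec_functor A) ⊗₁ bwd (t B X)) ≡ idm _.
  by rewrite -tensm_comp fwdK comp_idl tensm_id.
have F : fmap rec_functor (α A B X) ≡
    t A (B ⊗ X) ∘ (idm (rec_functor A) ⊗₁ t B X) ∘
    (α _ _ _ ∘ (bwd (t A B) ⊗₁ idm (rec_functor X)) ∘ bwd (t (A ⊗ B) X)).
  by rewrite -e !comp_assoc (comp_tail t2) comp_idr fwdK comp_idl.
by rewrite F !comp_assoc (comp_tail (bwdK _)) comp_idr (comp_tail t1) comp_idr.
Qed.

(** If [e0] satisfies the equation up to the global phase [v], then [v^-1 · e0]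
    satisfies it, as its two sides are linear and quadratic in [e]. *)
Fact rec_unit_ex : exists e : @Iso G munit (rec_functor munit),
  gp_basem (fwd e) ≡ K0 /\
  e ∘ gp_beta (gp_choice G) ≡
    fmap rec_functor (ρ munit) ∘ t munit munit ∘ (e ⊗₁ e).
Proof.
have [e0 be0] := gp_full HC (A := gp_I (gp_choice G)) (B := rec_ob munit) K0.
pose h1 : @Hom G _ _ := gp_comp e0 (fwd (gp_beta (gp_choice G))).
pose f0 : @Hom G munit (rec_functor munit) := e0.
have [v [Pv ev]] : qeq (gp_phases (G := G))
    (fmap rec_functor (ρ munit) ∘ t munit munit ∘ (f0 ⊗₁ f0)) h1.
  apply/(exq_ker (gp_forget_exhibits HC G)) => /=.
  rewrite !gp_basem_comp // rec_map_base rec_tens_base gp_tens_base // /f0 be0.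
  by rewrite gp_beta_base // mfun_unit_runit.
have HG := gp_global_phases HC G.
have [u [Pu _ uv]] := lscal_cancel HG Pv.
pose e := lscal u f0.
have be : gp_basem e ≡ K0.
  rewrite /e (gp_basem_heq HC (lscal_compl u f0)) gp_basem_comp //.
  rewrite (gp_lscal_phase HC _ ((gp_phasesP HC u).1 Pu)) comp_idl.
  exact: be0.
have [|i ei] := @invertible_iso G _ _ e.
  apply: (gp_invertible HC).
  by apply: (invertible_heq _ (iso_invertible K0)); exact: heq_sym.
exists i; rewrite ei; split=> //.
rewrite /e lscal_tensl (lscal_tensr HG) // comp_lscal_l !comp_lscal_r ev.
by rewrite uv.
Qed.

Definition rec_unit : @Iso G munit (rec_functor munit) :=
  sval (cid rec_unit_ex).
Local Notation e := rec_unit.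

Lemma rec_unit_base : gp_basem (fwd e) ≡ K0.
Proof. exact: (svalP (cid rec_unit_ex)).1. Qed.

Lemma rec_unitE : e ∘ gp_beta (gp_choice G) ≡
  fmap rec_functor (ρ munit) ∘ t munit munit ∘ (e ⊗₁ e).
Proof. exact: (svalP (cid rec_unit_ex)).2. Qed.

Fact rec_lunit (A : D) :
  fmap rec_functor (λ A) ∘ t munit A ∘ (e ⊗₁ idm (rec_functor A)) ≡
  λ (rec_functor A).
Proof.
apply: heq_sym; apply/(gpm_lunit (gp_spec G)).
exact: (unit_constraint_l rec_tens_nat rec_tens_assoc rec_unitE
  (iso_invertible e) A).
Qed.

Fact rec_runit (A : D) :
  fmap rec_functor (ρ A) ∘ t A munit ∘ (idm (rec_functor A) ⊗₁ e) ≡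
  ρ (rec_functor A).
Proof.
apply: heq_sym; apply/(gpm_runit (gp_spec G)).
exact: (unit_constraint_r rec_tens_nat rec_tens_assoc rec_unitE
  (iso_invertible e) A).
Qed.

Definition rec_mon_functor : MonFunctor D G :=
  Build_MonFunctor rec_tens_nat rec_tens_assoc rec_lunit rec_runit.

Lemma exhibits_quotient_gph_equiv : gph_equiv P (gp_phases (G := G)).
Proof.
exists rec_mon_functor; split.
  apply: equivalence_intro; [exact: rec_full | exact: rec_faithful |].
  exact: rec_surj.
(* A scalar of [G] is a phase exactly when its base is the identity. For the transport of [s] this
   means that [K] identifies [s] with [idm munit], that is, [s] lies in [P]. *)
move=> s; have be := gp_iso_base_inv HC rec_unit_base.
have -> : gp_phases (bwd e ∘ fmap rec_functor s ∘ e) <->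
    bwd K0 ∘ fmap K s ∘ K0 ≡ idm munit.
  rewrite (gp_phasesP HC) /gp_phase !gp_basem_comp // be rec_unit_base.
  by rewrite rec_map_base.
have -> : bwd K0 ∘ fmap K s ∘ K0 ≡ idm munit <->
    fmap K s ≡ fmap K (idm munit).
  rewrite fmap_id; split=> [es|->]; last by rewrite comp_idr bwdK.
  apply: (iso_epic (i := K0)); apply: (invertible_monic (iso_inv_invertible K0)).
  by rewrite comp_assoc es comp_idl bwdK.
rewrite (exq_ker HK); split=> [Ps|[u [Pu es]]].
  by exists s; split=> //; rewrite lscal_unit.
by apply: (gph_heq HP _ Pu); rewrite es lscal_unit.
Qed.

End Reconstruction.

Theorem corollary5p14 :
  (* GP(C) exists, for every choice of its data; it is a category of the second
     kind, and GP(C)_P is equivalent to C *)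
  (forall C : MonCat, phased_side C ->
     inhabited (GPChoice C) /\
     (forall ch : GPChoice C, exists G : GP C, gp_choice G = ch) /\
     (forall G : GP C,
        coproduct_side G /\
        exists HP : is_global_phases (gp_phases (G := G)),
          mon_equiv (quotient HP) C)) /\
  (* D_P is a category of the first kind, and GP(D_P) is equivalent to D,
     compatibly with the global phases *)
  (forall (D : MonCat) (P : Hom (@munit D) (@munit D) -> Prop)
     (HP : is_global_phases P), coproduct_side D ->
     phased_side (quotient HP) /\
     (forall G : GP (quotient HP), gph_equiv P (gp_phases (G := G)))) /\
  (* both assignments respect equivalence *)
  (forall C C' : MonCat, phased_side C -> phased_side C' -> mon_equiv C C' ->
     forall (G : GP C) (G' : GP C'),
       gph_equiv (gp_phases (G := G)) (gp_phases (G := G'))) /\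
  (forall (D D' : MonCat) (P : Hom (@munit D) (@munit D) -> Prop)
     (P' : Hom (@munit D') (@munit D') -> Prop)
     (HP : is_global_phases P) (HP' : is_global_phases P'),
     coproduct_side D -> coproduct_side D' -> gph_equiv P P' ->
     mon_equiv (quotient HP) (quotient HP')).
Proof.
split; [|split; [|split]].
- move=> C HC; split; first exact: gp_choice_exists.
  split=> [ch|G]; first exact: gp_exists.
  split; first exact: gp_coproduct_side.
  exists (gp_global_phases HC G).
  exact: exhibits_quotient_mon_equiv (gp_forget_exhibits HC G).
- move=> D P HP HD; have HQ := quotient_phased_side HP HD; split=> // G.
  exact: (exhibits_quotient_gph_equiv HP HD HQ (quotient_proj_exhibits HP) G).
- move=> C C' HC HC' [F eF] G G'.
  apply: (exhibits_quotient_gph_equiv (gp_global_phases HC G)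
    (gp_coproduct_side HC G) HC' _ G').
  exact: exhibits_quotient_compl (gp_forget_exhibits HC G) eF.
- move=> D D' P P' HP HP' _ _ [F [eF FP]].
  have HK := exhibits_quotient_compr HP' eF FP (quotient_proj_exhibits HP').
  exact: exhibits_quotient_mon_equiv HK.
Qed.
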